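(* Let $\Omega\subset\mathbb R^n$ be a bounded open set with $C^2$ boundary, let $L,F,G$ satisfy the assumptions below and $H$ be as below. Let $(u,m)$ be a mild solution of the constrained MFG problem in $\overline\Omega$ and let $(t,x)\in Q_m$. Then $$-p_1+H(x,p_2)=F(x,m(t))\qquad\forall(p_1,p_2)\in D^+u(t,x).$$
   Context: $T>0$; $U\supset\overline\Omega$ open; $\mathcal P(\overline\Omega)$ with the Kantorovich–Rubinstein distance $d_1$. Assumptions: (D1) $|F(x,m_1)-F(x,m_2)|+|G(x,m_1)-G(x,m_2)|\le\kappa d_1(m_1,m_2)$; (D2) $F(\cdot,m),G(\cdot,m)\in C^1_b(U)$, $|D_xF|+|D_xG|\le\kappa$; (D3) $x\mapsto F(x,m)$ semiconcave with linear modulus uniformly in $m$; (L0) $L\in C^1(U\times\mathbb R^n)$, $|L(x,0)|+|D_xL(x,0)|+|D_vL(x,0)|\le M$; (L1) $D_vL$ differentiable, $I/\mu\le D^2_{vv}L\le\mu I$, $\|D^2_{vx}L(x,v)\|\le\mu(1+|v|)$; (L2) $|D_xL(x,v)-D_xL(x,w)|\le C(R)|v-w|$ for $v,w\in B_R$; (L3) $x\mapsto L(x,v)$ semiconcave with linear modulus uniformly in $v\in B_R$. $H(x,p)=\sup_v\{-\langle p,v\rangle-L(x,v)\}$ (so that $H$ is $C^1$, strictly convex in $p$ with $I/\mu\le D_{pp}H\le\mu I$, and semiconvex in $x$ with linear modulus locally uniformly in $p$). $\Gamma$: absolutely continuous curves $[0,T]\to\overline\Omega$; $\Gamma_t[x]=\{\gamma:\gamma(t)=x\}$;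 $e_t(\gamma)=\gamma(t)$; $m^\eta(t)=e_t\sharp\eta$; $J_\eta[\gamma]=\int_0^T[L(\gamma,\dot\gamma)+F(\gamma,m^\eta(t))]dt+G(\gamma(T),m^\eta(T))$; $\Gamma^\eta[x]$ minimizers of $J_\eta$ over $\Gamma_0[x]$. Constrained MFG equilibrium for $m_0$: Borel probability $\eta$ on $\Gamma$ with $e_0\sharp\eta=m_0$ and $\mathrm{supp}\,\eta\subset\bigcup_x\Gamma^\eta[x]$. Mild solution: $(u,m)\in C([0,T]\times\overline\Omega)\times C([0,T];\mathcal P(\overline\Omega))$ with, for some equilibrium $\eta$, $m(t)=e_t\sharp\eta$ and $u(t,x)=\inf_{\gamma\in\Gamma_t[x]}\{\int_t^T[L(\gamma,\dot\gamma)+F(\gamma(s),m(s))]ds+G(\gamma(T),m(T))\}$. $Q_m=\{(t,x)\in(0,T)\times\Omega:x\in\mathrm{supp}(m(t))\}$. $D^+u(t,x)$ is the set of $(p_1,p_2)\in\mathbb R\times\mathbb R^n$ with $\limsup_{(s,y)\to(t,x),(s,y)\in(0,T)\times\overline\Omega}\frac{u(s,y)-u(t,x)-p_1(s-t)-\langle p_2,y-x\rangle}{|s-t|+|y-x|}\le0$. *)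

(* Defs.v *)
From HB Require Import structures.
From mathcomp Require Import all_boot all_order all_algebra.
From mathcomp Require Import all_classical all_reals all_analysis.
Unset Printing Implicit Defensive.
Import Order.TTheory GRing.Theory Num.Theory.
Import numFieldNormedType.Exports.
Local Open Scope classical_set_scope.
Local Open Scope ring_scope.

Definition BorelV (R : realType) (n : nat) := g_sigma_algebraType (@open 'rV[R]_n).
(* Borel probability measures on R^n; P(Omega-bar) is the subset of those
   concentrated on closure Omega (see [inP]) *)
Notation PV R n := (probability (BorelV R n) R).

(* Borel sigma-algebra of the space of curves R -> R^n (restricted to [0,T])
   endowed with the topology of uniform convergence on [0,T] *)
Definition sup_open (R : realType) (n : nat) (T : R) (A : set (R -> 'rV[R]_n)) :=
  forall g, A g -> exists2 r : R, 0 < r &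
    forall g', (forall s, `[0, T]%classic s -> `|g' s - g s| < r) -> A g'.
(* (the max-norm on 'rV is used here only to define the topology, which
   coincides with the euclidean one) *)
Definition CurveSpace (R : realType) (n : nat) (T : R) :=
  g_sigma_algebraType (@sup_open R n T).

Section Defs.
Context {R : realType} {n : nat}.
Local Notation V := 'rV[R]_n.

Definition icc (a b : R) : set R := `[a, b].
Definition ioo (a b : R) : set R := `]a, b[.

Definition dotv (p v : V) : R := \sum_(i < n) p 0 i * v 0 i.
Definition enorm (v : V) : R := Num.sqrt (dotv v v).
Definition evec (i : 'I_n) : V := delta_mx 0 i.
Definition ball_e (x : V) (r : R) : set V := [set y | enorm (y - x) < r].

Definition grad (f : V -> R) (x : V) : V := \row_i ('d f x (evec i)).

Definition C1_on {W : normedModType R} (A : set W) (f : W -> R) :=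
  (forall z, A z -> differentiable f z) /\
  (forall w, {in A, continuous (fun z => 'd f z w)}).
Definition C2_on {W : normedModType R} (A : set W) (f : W -> R) :=
  C1_on A f /\ forall w, C1_on A (fun z => 'd f z w).

Definition C2_boundary (O : set V) :=
  forall x0, (closure O `\` O) x0 ->
    exists r : R, 0 < r /\ exists rho : V -> R,
      [/\ C2_on (ball_e x0 r) rho, grad rho x0 != 0 &
          forall x, ball_e x0 r x -> (O x <-> rho x < 0)].

Definition semiconcave_lin (S : set V) (f : V -> R) (C : R) :=
  forall x h, (forall l : R, 0 <= l <= 1 -> S (x + (2 * l - 1) *: h)) ->
    f (x + h) + f (x - h) - 2 * f x <= C * enorm h ^+ 2.

Definition inP (O : set V) (m : PV R n) := m (~` closure O) = 0%E.

Definition lip1_on (A : set V) (f : V -> R) :=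
  forall x y, A x -> A y -> `|f x - f y| <= enorm (x - y).
Definition d1 (O : set V) (m1 m2 : PV R n) : \bar R :=
  ereal_sup [set (\int[m1]_(x in closure O) (f x)%:E
                 - \int[m2]_(x in closure O) (f x)%:E)%E | f in lip1_on (closure O)].

Definition meas_supp (mu : PV R n) : set V :=
  [set x | forall A : set V, open A -> A x -> (0 < mu A)%E].

Definition abs_cont_on (a b : R) (g : R -> V) :=
  forall eps : R, 0 < eps -> exists2 delta : R, 0 < delta &
    forall s : seq (R * R),
      all (fun p => (a <= p.1) && (p.1 <= p.2) && (p.2 <= b)) s ->
      sorted (fun p q : R * R => p.2 <= q.1) s ->
      \sum_(p <- s) (p.2 - p.1) < delta ->
      \sum_(p <- s) enorm (g p.2 - g p.1) < eps.

Definition Gamma (O : set V) (T : R) : set (R -> V) :=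
  [set g | abs_cont_on 0 T g /\ forall t, icc 0 T t -> closure O (g t)].

Definition cost (L : V -> V -> R) (F G : V -> PV R n -> R) (m : R -> PV R n)
    (T t : R) (g : R -> V) : \bar R :=
  (\int[lebesgue_measure]_(s in icc t T)
      (L (g s) (derive1 g s) + F (g s) (m s))%:E + (G (g T) (m T))%:E)%E.

(* Gamma^eta[x], with m(t) = e_t # eta *)
Definition minimizers (O : set V) (L : V -> V -> R) (F G : V -> PV R n -> R) (m : R -> PV R n) (T : R) (x : V) :
    set (R -> V) :=
  [set g | [/\ Gamma O T g, g 0 = x &
     forall g', Gamma O T g' -> g' 0 = x -> (cost L F G m T 0 g <= cost L F G m T 0 g')%E]].

Definition is_flow (T : R) (eta : probability (CurveSpace R n T) R) (m : R -> PV R n) :=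
  forall t, icc 0 T t -> forall A : set (BorelV R n), measurable A ->
    m t A = eta [set g : CurveSpace R n T | A (g t)].

Definition curve_supp (O : set V) (T : R) (eta : probability (CurveSpace R n T) R) :
    set (R -> V) :=
  [set g | Gamma O T g /\
     forall A : set (R -> V), @sup_open R n T A -> A g -> (0 < eta A)%E].

Definition equilibrium (O : set V) (L : V -> V -> R) (F G : V -> PV R n -> R) (T : R) (m0 : PV R n)
    (eta : probability (CurveSpace R n T) R) :=
  (eta (~` Gamma O T) = 0%E) /\
  (forall A : set (BorelV R n), measurable A ->
     m0 A = eta [set g : CurveSpace R n T | A (g 0)]) /\
  exists m : R -> PV R n, is_flow T eta m /\
    curve_supp O T eta `<=` \bigcup_(x in closure O) minimizers O L F G m T x.

Definition mild_solution (O : set V) (L : V -> V -> R) (F G : V -> PV R n -> R) (T : R) (m0 : PV R n)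
    (u : R -> V -> R) (m : R -> PV R n) :=
  [/\ {within icc 0 T `*` closure O, continuous (fun z : R * V => u z.1 z.2)},
      (forall t, icc 0 T t -> inP O (m t)),
      (forall t, icc 0 T t -> forall eps : R, 0 < eps -> exists2 delta : R, 0 < delta &
          forall s, icc 0 T s -> `|s - t| < delta -> (d1 O (m s) (m t) < eps%:E)%E) &
      exists eta : probability (CurveSpace R n T) R,
        [/\ equilibrium O L F G T m0 eta, is_flow T eta m &
            forall t x, icc 0 T t -> closure O x ->
              (u t x)%:E = ereal_inf [set cost L F G m T t g |
                                       g in [set g | Gamma O T g /\ g t = x]]]].

Definition Qm (O : set V) (T : R) (m : R -> PV R n) : set (R * V) :=
  [set tx | [/\ ioo 0 T tx.1, O tx.2 & meas_supp (m tx.1) tx.2]].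

Definition superdiff (O : set V) (T : R) (u : R -> V -> R) (t : R) (x : V) :
    set (R * V) :=
  [set p | forall eps : R, 0 < eps -> exists2 delta : R, 0 < delta &
     forall s y, ioo 0 T s -> closure O y ->
       0 < `|s - t| + enorm (y - x) < delta ->
       u s y - u t x - p.1 * (s - t) - dotv p.2 (y - x)
         <= eps * (`|s - t| + enorm (y - x))].

Definition hamiltonian (L : V -> V -> R) (x p : V) : \bar R :=
  ereal_sup [set (- dotv p v - L x v)%:E | v in [set: V]].

Definition LJ (L : V -> V -> R) (z : V * V) : R := L z.1 z.2.
Definition DxL (L : V -> V -> R) (x v : V) : V := \row_i ('d (LJ L) (x, v) (evec i, 0)).
Definition DvL (L : V -> V -> R) (x v : V) : V := \row_i ('d (LJ L) (x, v) (0, evec i)).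
Definition DvLJ (L : V -> V -> R) (z : V * V) : V := DvL L z.1 z.2.

Definition assum_L (U : set V) (L : V -> V -> R) (M mu : R) :=
  [/\
      C1_on (U `*` [set: V]) (LJ L) /\
      (forall x, U x -> `|L x 0| + enorm (DxL L x 0) + enorm (DvL L x 0) <= M),
      (forall z, (U `*` [set: V]) z -> differentiable (DvLJ L) z) /\
      (forall x v w, U x ->
         enorm w ^+ 2 / mu <= dotv ('d (DvLJ L) (x, v) (0, w)) w <= mu * enorm w ^+ 2 /\
         enorm ('d (DvLJ L) (x, v) (w, 0)) <= mu * (1 + enorm v) * enorm w),
      (forall Rr : R, exists C : R, forall x v w, U x -> enorm v <= Rr -> enorm w <= Rr ->
         enorm (DxL L x v - DxL L x w) <= C * enorm (v - w)) &
      (forall Rr : R, exists C : R, forall v, enorm v <= Rr ->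
         semiconcave_lin U (fun x => L x v) C)].

Definition assum_FG (O U : set V) (F G : V -> PV R n -> R) (kappa : R) :=
  [/\
      (forall x m1 m2, U x -> inP O m1 -> inP O m2 ->
         ((`|F x m1 - F x m2| + `|G x m1 - G x m2|)%:E <= kappa%:E * d1 O m1 m2)%E),
      (forall m, inP O m ->
         [/\ C1_on U (F^~ m), C1_on U (G^~ m),
             exists C : R, forall x, U x -> `|F x m| <= C /\ `|G x m| <= C &
             forall x, U x -> enorm (grad (F^~ m) x) + enorm (grad (G^~ m) x) <= kappa]) &
      exists C : R, forall m, inP O m -> semiconcave_lin U (F^~ m) C].

End Defs.

(* Main.v *)
Require Import Defs.
From HB Require Import structures.
From mathcomp Require Import all_boot all_order all_algebra.
From mathcomp Require Import all_classical all_reals all_analysis.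
From mathcomp Require Import measurable_realfun lra ring.
Import Order.TTheory GRing.Theory Num.Theory.
Import numFieldNormedType.Exports.
Local Open Scope classical_set_scope.
Local Open Scope ring_scope.
Set Implicit Arguments.
Unset Strict Implicit.
Unset Printing Implicit Defensive.

(* The inequality -p1 + H(x,p2) <= F holds at every interior point: follow the
   line x + s v for a short time, continue with an almost optimal curve, and
   insert the resulting bound u(t,x) <= int (L + F) + u(t+h,x+hv) in the
   definition of the superdifferential.

   For the converse, x in supp m(t) yields minimizers g in supp eta with g(t)
   arbitrarily close to x.  By Bellman's principle
   int_{t-h}^t (L + F) <= u(t-h,g(t-h)) - u(t,g(t)), and the superdifferential
   bounds the right hand side by -p1 h - p2.D + eps |D| + o(h) with
   D = g(t) - g(t-h).  On the other side L(y,v) + p2.v - eps |v| is at least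
   -H(x,p2) - O(eps) for y near x, by the quadratic growth of L in v, so that
   the fundamental theorem of calculus for absolutely continuous curves bounds
   the integral from below by -p2.D + eps |D| + h (F - H(x,p2) - O(eps)).
   Dividing by h gives F + p1 <= H(x,p2).  The point g(t-h) is close to x
   uniformly in g because the superlinear growth of L makes the minimizers
   equicontinuous; no compactness or regularity of minimizers is needed. *)

(** * Integrals of possibly non-measurable functions *)

(* Measurability of the running cost along a curve is never needed: the library
   integral is the difference of the lower integrals of the positive and negative
   parts, which is monotone, and additive over disjoint measurable sets. *)

(** The displacement D of an optimal curve over a time h is not known to be O(h), so the remainder
    eps |D| of the superdifferential cannot be counted as o(h). It is cancelled instead: the growth
    of L leaves a surplus eps |v| in the pointwise bound, and a vector e with |e| <= 1 and e.D = |D|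
    turns this surplus into the linear minorant eps e.v, whose integral is exactly eps |D|. Hence
    every lower bound on an action is linear in the velocity, and only scalar functions q.g have to
    be integrated. The optimal curve need not pass through x either. This fixes the order of the
    choices: eps, then h by equicontinuity, then a curve for which |g(t) - x| and |u(t,g(t)) -
    u(t,x)| are of order eps h. The supremum defining H is an extended real; it is finite as a
    consequence of the first inequality. The flow carried by the definition of an equilibrium and
    the flow m of the mild solution agree on Borel sets only, so optimality is transferred from one
    to the other through the fact that F and G do not separate measures at distance d1 = 0. *)

Section lower_integral.
Local Open Scope ereal_scope.
Context d (X : measurableType d) (R : realType).
Variable mu : {measure set X -> \bar R}.
Implicit Types (f g : X -> \bar R) (A B D : set X).

Import HBNNSimple.

Lemma le_lower_integral_ge0 D f g : (forall x, D x -> 0 <= f x) ->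
  (forall x, D x -> f x <= g x) ->
  \int[mu]_(x in D) f x <= \int[mu]_(x in D) g x.
Proof.
move=> f0 fg; have g0 x : D x -> 0 <= g x.
  by move=> Dx; exact: le_trans (f0 _ Dx) (fg _ Dx).
rewrite !ge0_integralE//; apply: ge_ereal_sup => _ [h /= hf <-].
apply: ereal_sup_ubound; exists h => //= x; apply: le_trans (hf x) _.
by rewrite /patch; case: ifPn => // /[1!inE]; exact: fg.
Qed.

Lemma le_lower_integral D f g : (forall x, D x -> f x <= g x) ->
  \int[mu]_(x in D) f x <= \int[mu]_(x in D) g x.
Proof.
move=> fg; rewrite integralE [leRHS]integralE leeB//.
  apply: le_lower_integral_ge0 => // x Dx.
  by apply: (@funepos_le _ _ D) => [y /[1!inE]|]; [exact: fg|rewrite inE].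
apply: le_lower_integral_ge0 => // x Dx.
by apply: (@funeneg_le _ _ D) => [y /[1!inE]|]; [exact: fg|rewrite inE].
Qed.

(** Only the sets have to be measurable: a simple function below [f] on the union is the sum of its
    restrictions to [A] and [B], and conversely simple functions below [f] on [A] and on [B] add up
    to one below [f] on the union. *)
Lemma lower_integral_setU_ge0 A B f : measurable A -> measurable B ->
  A `&` B = set0 -> (forall x, 0 <= f x) ->
  \int[mu]_(x in A `|` B) f x = \int[mu]_(x in A) f x + \int[mu]_(x in B) f x.
Proof.
move=> mA mB AB0 f0; rewrite !ge0_integralE//.
apply/eqP; rewrite eq_le; apply/andP; split.
  apply: ge_ereal_sup => _ [h /= hf <-].
  (* Off the union, [h] is both nonnegative and at most 0, so nothing is lost by restricting it. *)
  have -> : sintegral mu h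
      = sintegral mu (add_nnsfun (proj_nnsfun h mA) (proj_nnsfun h mB)).
    apply: eq_sintegral => x /=; rewrite !measurable_realfun.mindicE.
    have := hf x; rewrite /patch in_setU.
    have [xA|xA] := boolP (x \in A); have [xB|xB] := boolP (x \in B) => /=.
    - suff: (A `&` B) x by rewrite AB0.
      by move: xA xB; rewrite !inE.
    - by rewrite mulr1 mulr0 addr0.
    - by rewrite mulr1 mulr0 add0r.
    - rewrite !mulr0 addr0 lee_fin => h0; apply/eqP.
      by rewrite eq_le h0/=; exact: fun_ge0.
  rewrite sintegralD; apply: leeD; apply: ereal_sup_ubound => /=.
    exists (proj_nnsfun h mA) => //= x; rewrite measurable_realfun.mindicE.
    have := hf x; rewrite /patch in_setU.
    by case: (x \in A) => /=; rewrite ?mulr1 ?mulr0.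
  exists (proj_nnsfun h mB) => //= x; rewrite measurable_realfun.mindicE.
  have := hf x; rewrite /patch in_setU.
  by case: (x \in B) => /=; rewrite ?mulr1 ?mulr0// orbT.
set S := (leRHS).
have H (h1 h2 : {nnsfun X >-> R}) : (forall x, (h1 x)%:E <= (f \_ A) x) ->
    (forall x, (h2 x)%:E <= (f \_ B) x) ->
    sintegral mu h1 + sintegral mu h2 <= S.
  move=> h1f h2f; rewrite -sintegralD; apply: ereal_sup_ubound.
  exists (add_nnsfun h1 h2) => //= x; rewrite EFinD.
  apply: le_trans (leeD (h1f x) (h2f x)) _; rewrite /patch in_setU.
  have [xA|xA] := boolP (x \in A); have [xB|xB] := boolP (x \in B) => /=.
  - suff: (A `&` B) x by rewrite AB0.
    by move: xA xB; rewrite !inE.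
  - by rewrite adde0.
  - by rewrite add0e.
  - by rewrite adde0.
have [->|Soo] := eqVneq S +oo; first exact: leey.
have S0 : 0 <= S.
  by apply: ereal_sup_ubound; exists nnsfun0;
    [move=> x /=; exact: erestrict_ge0|exact: sintegral0].
have nn0 D : (forall x, ((nnsfun0 : {nnsfun X >-> R}) x)%:E <= (f \_ D) x).
  by move=> x /=; exact: erestrict_ge0.
have Sfin (h : {nnsfun X >-> R}) : sintegral mu h <= S -> sintegral mu h \is a fin_num.
  by move=> hS; rewrite ge0_fin_numE ?sintegral_ge0// (le_lt_trans hS)// ltey.
set SA := (Z in Z + _ <= _); set SB := (Z in _ + Z <= _).
have SA_fin : SA \is a fin_num.
  rewrite ge0_fin_numE; last first.
    by apply: ereal_sup_ubound; exists nnsfun0; [exact: nn0|exact: sintegral0].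
  apply: le_lt_trans (_ : S < +oo); last by rewrite ltey.
  apply: ge_ereal_sup => _ [h1 /= h1f <-].
  by have := H _ _ h1f (nn0 B); rewrite sintegral0 adde0.
rewrite addeC -leeBrDr//; apply: ge_ereal_sup => _ [h2 /= h2f <-].
have h2fin : sintegral mu h2 \is a fin_num.
  by apply: Sfin; have := H _ _ (nn0 A) h2f; rewrite sintegral0 add0e.
rewrite leeBrDr// addeC -leeBrDr//; apply: ge_ereal_sup => _ [h1 /= h1f <-].
by rewrite leeBrDr//; exact: H.
Qed.

(** Both parts of [f] lie below the constant [+oo], whose integral over a null set is
    [+oo * 0 = 0]. *)
Lemma lower_integral_null D f : measurable D -> mu D = 0 ->
  \int[mu]_(x in D) f x = 0.
Proof.
move=> mD D0; have H g : (forall x, 0 <= g x) -> \int[mu]_(x in D) g x = 0.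
  move=> g0; apply/eqP; rewrite eq_le integral_ge0// andbT.
  have := @le_lower_integral_ge0 D g (cst +oo) (fun x _ => g0 x) (fun x _ => leey _).
  by rewrite integral_cst// D0 mule0.
by rewrite integralE !H// subee.
Qed.

(** The lower bound [K] on sets of finite measure makes the negative parts integrate to finite
    numbers, so the four terms can be regrouped without meeting [+oo - +oo]. *)
Lemma lower_integral_setU A B f (K : R) : measurable A -> measurable B ->
  mu A < +oo -> mu B < +oo -> A `&` B = set0 ->
  (forall x, (A `|` B) x -> K%:E <= f x) ->
  \int[mu]_(x in A `|` B) f x = \int[mu]_(x in A) f x + \int[mu]_(x in B) f x.
Proof.
move=> mA mB Aoo Boo AB0 Kf.
have fneg D : measurable D -> mu D < +oo -> (forall x, D x -> K%:E <= f x) ->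
    \int[mu]_(x in D) f^\- x \is a fin_num.
  move=> mD Doo KfD; rewrite ge0_fin_numE ?integral_ge0//.
  apply: (@le_lt_trans _ _ (\int[mu]_(x in D) (cst `|K|%:E) x)).
    apply: le_lower_integral_ge0 => //= x Dx.
    rewrite funenegE ge_max lee_fin normr_ge0 andbT.
    by rewrite leeNl -EFinN (le_trans _ (KfD _ Dx))// lee_fin lerNnormlW.
  by rewrite integral_cst// lte_mul_pinfty.
rewrite integralE [in RHS]integralE [X in _ = _ + X]integralE.
rewrite !lower_integral_setU_ge0// fin_num_oppeD; last first.
  by apply: fneg => // x Ax; apply: Kf; right.
by rewrite addeACA.
Qed.
End lower_integral.

Section interval_integral.
Local Open Scope ereal_scope.
Context {R : realType}.
Local Notation lam := (@lebesgue_measure R).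
Implicit Types (f g : R -> R) (a b c K : R).

Lemma lebesgue_itv_lty (i : interval R) a b : [set` i] `<=` `[a, b]%classic ->
  lam [set` i] < +oo.
Proof.
move=> iab; apply: (@le_lt_trans _ _ (lam `[a, b]%classic)).
  by apply: le_measure => //; rewrite inE; exact: measurable_itv.
by rewrite lebesgue_measure_itv/=; case: ifP => _; rewrite ?ltry// -EFinB ltry.
Qed.

(** Endpoints have to be discarded because the derivative of a glued curve or of a segment is only
    controlled on the open interval. *)
Lemma lower_integral_ccE f a b K : (forall s, `[a, b]%classic s -> (K <= f s)%R) ->
  \int[lam]_(s in `[a, b]) (f s)%:E = \int[lam]_(s in `]a, b[) (f s)%:E.
Proof.
move=> Kf; have [ab|ab|<-] := ltgtP a b; last 2 first.
- have -> : `[a, b]%classic = set0 by rewrite set_itv_ge// bnd_simp -ltNge.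
  by rewrite set_itv_ge ?bnd_simp -?leNgt ?ltW// !integral_set0.
- rewrite set_itv1 lower_integral_null//; last exact: lebesgue_measure_set1.
  by rewrite set_itvoo0 integral_set0.
have abE : `[a, b]%classic = [set a; b] `|` `]a, b[%classic.
  by rewrite setUC setUitv_set2// ltW.
have lab : lam [set a; b] = 0.
  apply/eqP; rewrite -measure_le0; apply: le_trans (measureU2 _ _ _) _ => //.
  by rewrite [X in X + _]lebesgue_measure_set1 [X in _ + X]lebesgue_measure_set1 adde0.
rewrite abE (@lower_integral_setU _ _ _ _ _ _ _ K)//.
- rewrite lower_integral_null ?add0e//; exact: measurableU.
- exact: measurableU.
- by rewrite [ltLHS]lab.
- by apply: (@lebesgue_itv_lty _ a b); exact: subset_itv_oo_cc.
- by apply/seteqP; split => // s /= [[->|->]]; rewrite in_itv/= ltxx ?andbF.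
- by move=> s; rewrite -abE => abs; rewrite lee_fin; exact: Kf.
Qed.

Lemma lower_integral_cat f a b c K : (a <= c <= b)%R ->
  (forall s, `[a, b]%classic s -> (K <= f s)%R) ->
  \int[lam]_(s in `[a, b]) (f s)%:E =
  \int[lam]_(s in `[a, c]) (f s)%:E + \int[lam]_(s in `[c, b]) (f s)%:E.
Proof.
move=> /andP[ac cb] Kf.
have E : `[a, b]%classic = `[a, c]%classic `|` `]c, b]%classic.
  by rewrite -itv_bndbnd_setU// bnd_simp.
have Kf2 s : `[c, b]%classic s -> (K <= f s)%R.
  by move=> /= cs; apply: Kf => /=; apply: subset_itvr cs; rewrite bnd_simp.
have -> : \int[lam]_(s in `[c, b]) (f s)%:E = \int[lam]_(s in `]c, b]) (f s)%:E.
  move: cb; rewrite le_eqVlt => /predU1P[<-|cb].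
    rewrite set_itv1 lower_integral_null//; last exact: lebesgue_measure_set1.
    by rewrite set_itvoc0 integral_set0.
  have cbE : `[c, b]%classic = [set c] `|` `]c, b]%classic.
    by rewrite setU1itv // bnd_simp ltW.
  rewrite cbE (@lower_integral_setU _ _ _ _ _ _ _ K)//.
  - by rewrite lower_integral_null ?add0e//; exact: lebesgue_measure_set1.
  - by rewrite [ltLHS]lebesgue_measure_set1.
  - by apply: (@lebesgue_itv_lty _ c b); exact: subset_itv_oc_cc.
  - by apply/seteqP; split => // s /= [->]; rewrite in_itv/= ltxx.
  - by move=> s; rewrite -cbE => cs; rewrite lee_fin; exact: Kf2.
rewrite E (@lower_integral_setU _ _ _ _ _ _ _ K)//.
- by apply: (@lebesgue_itv_lty _ a c).
- by apply: (@lebesgue_itv_lty _ c b); exact: subset_itv_oc_cc.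
- apply/seteqP; split => // s /= [/=]; rewrite !in_itv/= => /andP[_ sc] /andP[cs _].
  by move: (lt_le_trans cs sc); rewrite ltxx.
- by move=> s; rewrite -E => abs; rewrite lee_fin; exact: Kf.
Qed.

Lemma eq_lower_integral f g a b K : (forall s, `[a, b]%classic s -> (K <= f s)%R) ->
  (forall s, `[a, b]%classic s -> (K <= g s)%R) ->
  (forall s, `]a, b[%classic s -> f s = g s) ->
  \int[lam]_(s in `[a, b]) (f s)%:E = \int[lam]_(s in `[a, b]) (g s)%:E.
Proof.
move=> Kf Kg fg; rewrite !(@lower_integral_ccE _ _ _ K)//.
by apply: eq_integral => s /[!inE] /fg ->.
Qed.

Lemma lower_integral_le_cst f a b c K : (a <= b)%R ->
  (forall s, `[a, b]%classic s -> (K <= f s)%R) ->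
  (forall s, `]a, b[%classic s -> (f s <= c)%R) ->
  \int[lam]_(s in `[a, b]) (f s)%:E <= (c * (b - a))%:E.
Proof.
move=> ab Kf fc; rewrite (@lower_integral_ccE _ _ _ K)//.
apply: (@le_trans _ _ (\int[lam]_(s in `]a, b[) (cst c%:E) s)).
  by apply: le_lower_integral => s abs; rewrite lee_fin; exact: fc.
rewrite integral_cst//.
rewrite [X in _ * X]lebesgue_measure_itv/= lte_fin.
case: ifPn => [_|]; first by rewrite -EFinB EFinM.
by rewrite -leNgt => ba; have /eqP -> : a == b by [rewrite eq_le ab ba];
  rewrite subrr mulr0 mule0.
Qed.

Lemma lower_integral_ge_cst f a b c : (a <= b)%R ->
  (forall s, `[a, b]%classic s -> (c <= f s)%R) ->
  (c * (b - a))%:E <= \int[lam]_(s in `[a, b]) (f s)%:E.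
Proof.
move=> ab fc.
apply: (@le_trans _ _ (\int[lam]_(s in `[a, b]) (cst c%:E) s)).
  rewrite integral_cst//.
  rewrite [X in _ * X]lebesgue_measure_itv/= lte_fin.
case: ifPn => [_|]; first by rewrite -EFinB EFinM.
  by rewrite -leNgt => ba; have /eqP -> : a == b by [rewrite eq_le ab ba];
  rewrite subrr mulr0 mule0.
by apply: le_lower_integral => s abs; rewrite lee_fin; exact: fc.
Qed.

End interval_integral.

(** * The fundamental theorem of calculus for absolutely continuous functions *)

Section scalar_abs_cont.
Context {R : realType}.
Implicit Types (f g : R -> R) (a b : R).

Definition valid_pairs a b (s : seq (R * R)) :=
  all (fun p => (a <= p.1) && (p.1 <= p.2) && (p.2 <= b)) s /\
  sorted (fun p q : R * R => p.2 <= q.1) s.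

Definition abs_cont a b f :=
  forall eps : R, 0 < eps -> exists2 delta : R, 0 < delta &
    forall s : seq (R * R), valid_pairs a b s ->
      \sum_(p <- s) (p.2 - p.1) < delta ->
      \sum_(p <- s) `|f p.2 - f p.1| < eps.

Lemma abs_cont_unif a b f : abs_cont a b f ->
  forall eps : R, 0 < eps -> exists2 delta : R, 0 < delta &
    forall x y, a <= x <= b -> a <= y <= b -> `|x - y| < delta ->
      `|f x - f y| < eps.
Proof.
move=> acf e e0; have [d d0 fd] := acf e e0; exists d => // x y.
wlog xy : x y / x <= y.
  move=> H xab yab; have [|/ltW] := leP x y; first by move=> xy; exact: H.
  by move=> yx; rewrite distrC [in X in _ -> X]distrC; exact: H.
move=> /andP[ax xb] /andP[ay yb]; rewrite distrC ger0_norm ?subr_ge0// => yxd.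
have := fd [:: (x, y)]; rewrite !big_seq1/= distrC; apply => //.
by split => //=; rewrite ax xy yb.
Qed.

End scalar_abs_cont.

(** * Monotone functions: absolute continuity of the Stieltjes measure *)

Section monotone_abs_cont.
Context {R : realType} (T : R) (h : R -> R).
Hypothesis T0 : 0 < T.
Hypothesis ndh : forall x y : R, 0 <= x -> x <= y -> y <= T -> h x <= h y.
Hypothesis ach : abs_cont 0 T h.
Local Notation lam := (@lebesgue_measure R).

(** Extends [h] by constants outside [0, T]: a Stieltjes measure is built from a nondecreasing
    right-continuous function on the whole line. *)
Let clip (x : R) : R := Num.min (Num.max x 0) T.

Let clipE x : 0 <= x <= T -> clip x = x.
Proof. by move=> /andP[x0 xT]; rewrite /clip max_l// min_l. Qed.

Let clip_itv x : 0 <= clip x <= T.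
Proof.
rewrite /clip ge_min lexx orbT andbT le_min (ltW T0) andbT.
by rewrite le_max lexx orbT.
Qed.

Let clip_nd x y : x <= y -> clip x <= clip y.
Proof.
move=> xy; rewrite /clip le_min ge_min (ge_min T) lexx orbT andbT.
by rewrite ge_max !le_max xy lexx orbT.
Qed.

Let clip_lip x y : `|clip x - clip y| <= `|x - y|.
Proof.
wlog xy : x y / x <= y.
  move=> H; have [|/ltW] := leP x y; first by move=> xy; exact: H.
  by move=> yx; rewrite distrC (distrC x); exact: H.
rewrite distrC (distrC x) !ger0_norm ?subr_ge0//; last exact: clip_nd.
rewrite /clip /Num.min /Num.max.
by do 4 case: ifPn; rewrite -?leNgt; move=> *; lra.
Qed.

Let hc (x : R) : R := h (clip x).

Let hc_nd : {homo hc : x y / x <= y}.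
Proof.
move=> x y xy; have /andP[? ?] := clip_itv x; have /andP[? ?] := clip_itv y.
by apply: ndh => //; exact: clip_nd.
Qed.

Let hc_cont : continuous hc.
Proof.
move=> x; apply/cvgrPdist_lt => e e0.
have [d d0 hd] := abs_cont_unif ach e0.
near=> y; rewrite distrC; apply: hd => //; apply: le_lt_trans (clip_lip _ _) _.
by near: y; apply: cvgr_distC_lt.
Unshelve. all: by end_near. Qed.

Let hc_rc : forall x, hc @ at_right x --> hc x.
Proof. exact: right_continuousW hc_cont. Qed.

Let H : cumulative R R := HB.pack hc (isCumulative.Build R _ R hc hc_nd hc_rc).

Let lsm : {measure set (measurableTypeR R) -> \bar R} :=
  lebesgue_stieltjes_measure H.

Let lsm_itv a b : a <= b -> lsm `]a, b]%classic = (hc b - hc a)%:E.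
Proof.
move=> ab; rewrite /lsm /= /lebesgue_stieltjes_measure /measure_extension.
by rewrite measurable_mu_extE/= ?wlength_itv_bnd//; exact: is_ocitv.
Qed.

(** Dyadic cells, open on the left so that those of one level are disjoint and [lsm_itv] gives their
    Stieltjes measure. Those with k < 2^n fill ]0, T]. *)
Let cell n k : set R := `]T * k%:R / 2 ^+ n, T * k.+1%:R / 2 ^+ n].

(** The child has index 2k or 2k+1 according to the side of the midpoint on which [x] lies. The
    equality of truth values says that parent and child are both inside ]0, T] or both outside. *)
Let cell_split n k x : cell n k x ->
  exists2 k', cell n.+1 k' x /\ (k' < 2 ^ n.+1 = (k < 2 ^ n))%N &
              cell n.+1 k' `<=` cell n k.
Proof.
have p0 : 0 < (2 : R) ^+ n by rewrite exprn_gt0.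
have eL j : T * j%:R / 2 ^+ n = T * (2 * j)%:R / 2 ^+ n.+1.
  by rewrite exprS natrM; field; rewrite gt_eqF.
rewrite /cell /= in_itv/= => /andP[kx xk].
have [xm|mx] := leP x (T * (2 * k).+1%:R / 2 ^+ n.+1).
  exists (2 * k)%N; first split.
  - by rewrite /= in_itv/= -eL kx xm.
  - by rewrite expnS ltn_pmul2l.
  - move=> y /=; rewrite !in_itv/= -eL => /andP[-> /=] /le_trans; apply.
    rewrite eL mulnS ler_pM2r ?invr_gt0 ?exprn_gt0// ler_pM2l// ler_nat.
    by rewrite add2n.
exists (2 * k).+1; first split.
- by rewrite /= in_itv/= mx/= (le_trans xk)// eL mulnS add2n.
- by rewrite expnS !mul2n ltn_Sdouble.
- move=> y /=; rewrite !in_itv/= => /andP[ky yk]; apply/andP; split; last first.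
    by rewrite (le_trans yk)// eL mulnS add2n.
  apply: le_lt_trans ky; rewrite eL ler_pM2r ?invr_gt0 ?exprn_gt0// ler_pM2l//.
  by rewrite ler_nat.
Qed.

Let cell_ex n x : 0 < x <= T -> exists2 k, (k < 2 ^ n)%N & cell n k x.
Proof.
move=> xT; elim: n => [|n [k kn /cell_split[k' [kx kk'] _]]].
  by exists 0%N => //; rewrite /cell/= in_itv/= expr0 mulr0 mul0r divr1 mulr1.
by exists k' => //; rewrite kk'.
Qed.

Let cell_triv n : trivIset setT (cell n).
Proof.
apply/trivIsetP => i j _ _.
wlog ij : i j / (i < j)%N.
  move=> W; rewrite neq_ltn => /orP[ij|ji]; first by apply: W => //; rewrite neq_ltn ij.
  by rewrite setIC; apply: W => //; rewrite neq_ltn ji.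
move=> _; apply/seteqP; split => // x []; rewrite /cell/= !in_itv/=.
move=> /andP[_ xi] /andP[jx _]; move: (lt_le_trans jx xi).
rewrite ltNge ler_pM2r ?invr_gt0 ?exprn_gt0// ler_pM2l// ler_nat.
by rewrite ij.
Qed.

(* A null set is covered by an open set of small length, which is the increasing
   union of the dyadic cells it contains; the absolute continuity of h bounds the
   Stieltjes measure of finitely many such cells. *)
Let lsm_null (A : set R) : measurable A -> A `<=` `]0, T]%classic ->
  lam A = 0%E -> lsm A = 0%E.
Proof.
move=> mA AT A0; apply/eqP; rewrite eq_le measure_ge0 andbT.
apply/lee_addgt0Pr => e e0; rewrite add0e.
have [d d0 hd] := ach e0.
have Aoo : (lam A < +oo)%E by rewrite [X in (X < _)%E]A0 ltry.
have [U [oU AU UA]] := lebesgue_regularity_outer mA Aoo d0.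
have mU : measurable U by exact: open_measurable.
have Ud : (lam U < d%:E)%E.
  rewrite -(setDUK AU); apply: le_lt_trans (measureU2 _ _ _) _ => //.
    exact: measurableD.
  by rewrite [X in (X + _)%E]A0 add0e.
pose P n k := `[< cell n k `<=` U >].
pose Un n := \big[setU/set0]_(k < 2 ^ n | P n k) cell n k.
have mcell n k : measurable (cell n k) by exact: measurable_itv.
have mUn n : measurable (Un n) by apply: bigsetU_measurable => k _; exact: mcell.
have UnP n x : Un n x <-> exists2 k, (k < 2 ^ n)%N /\ P n k & cell n k x.
  rewrite /Un -bigcup_seq_cond; split => [[k /= /andP[_ Pk] kx]|[k [kn Pk] kx]].
    by exists k => //; split.
  by exists (Ordinal kn) => //=; rewrite mem_index_enum Pk.
have UnU n : Un n `<=` U by move=> x /UnP[k [_ /asboolP]]; exact.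
have triv n : trivIset setT (fun k : 'I_(2 ^ n) => cell n k).
  by move=> i j _ _ /(cell_triv I I)/val_inj.
pose s n := [seq (T * k%:R / 2 ^+ n, T * k.+1%:R / 2 ^+ n) | k <- iota 0 (2 ^ n) & P n k].
have le_cell n (k : nat) : T * k%:R / 2 ^+ n <= T * k.+1%:R / 2 ^+ n.
  by rewrite ler_pM2r ?invr_gt0 ?exprn_gt0// ler_pM2l// ler_nat.
have cbd n j : (j <= 2 ^ n)%N -> 0 <= T * j%:R / 2 ^+ n <= T.
  move=> jn; rewrite divr_ge0 ?mulr_ge0 ?exprn_ge0 ?(ltW T0)//=.
  by rewrite ler_pdivrMr ?exprn_gt0// ler_pM2l// -natrX ler_nat.
have sn_valid n : valid_pairs 0 T (s n).
  split.
    apply/allP => p /mapP[k]; rewrite mem_filter mem_iota add0n => /andP[_ /= kn] ->/=.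
    have /andP[-> _] := cbd n _ (ltnW kn); have /andP[_ ->] := cbd n _ kn.
    by rewrite le_cell.
  rewrite sorted_map; apply: (@sub_sorted _ ltn).
    move=> i j ij /=.
    by rewrite ler_pM2r ?invr_gt0 ?exprn_gt0// ler_pM2l// ler_nat.
  apply: sorted_filter; [exact: ltn_trans|exact: iota_ltn_sorted].
have sumE n (F : R -> R -> R) : \sum_(p <- s n) F p.2 p.1 =
    \sum_(k < 2 ^ n | P n k) F (T * k.+1%:R / 2 ^+ n) (T * k%:R / 2 ^+ n).
  rewrite big_map big_filter -[in RHS](big_mkord (P n)
    (fun k => F (T * k.+1%:R / 2 ^+ n) (T * k%:R / 2 ^+ n))).
  by rewrite /index_iota subn0.
have sn_len n : \sum_(p <- s n) (p.2 - p.1) < d.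
  rewrite (sumE n (fun x y => x - y)) -lte_fin -sumEFin.
  apply: le_lt_trans Ud.
  apply: (@le_trans _ _ (lam (Un n))); last first.
    by apply: le_measure; [exact: (mem_set (mUn n))|exact: (mem_set mU)|exact: UnU].
  rewrite /Un measure_bigsetU_ord//; last by move=> i; exact: mcell.
  apply: lee_sum => k _.
  rewrite [leRHS]lebesgue_measure_itv/= lte_fin; case: ifPn => [_|]; first by rewrite EFinB.
  by rewrite -leNgt lee_fin subr_le0.
have lsmUn n : (lsm (Un n) <= e%:E)%E.
  rewrite /Un measure_bigsetU_ord//=; last by move=> i; exact: mcell.
  have lsmE k : lebesgue_stieltjes_measure H (cell n k) =
      (hc (T * k.+1%:R / 2 ^+ n) - hc (T * k%:R / 2 ^+ n))%:E by exact: lsm_itv.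
  under eq_bigr do rewrite lsmE.
  rewrite sumEFin lee_fin; apply: ltW; apply: le_lt_trans (hd _ (sn_valid n) (sn_len n)).
  rewrite (sumE n (fun x y => `|h x - h y|)); apply: ler_sum => k _.
  by rewrite /hc !clipE ?ler_norm// cbd// ltnW.
have AUn : A `<=` \bigcup_n Un n.
  move=> x Ax.
  have /nbhs_ballP[r /= r0 rU] : nbhs x U by apply: open_nbhs_nbhs; split => //; exact: AU.
  (* Since 2^n > n > T / r, the cell of level [n] around [x] is shorter than [r] and stays in the
     ball contained in [U]. *)
  pose n := (Num.truncn (T / r)).+1.
  have Tn : T / 2 ^+ n < r.
    rewrite ltr_pdivrMr ?exprn_gt0// mulrC -ltr_pdivrMr//.
    apply: lt_le_trans (truncnS_gt _) _; rewrite -natrX ler_nat.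
    by rewrite ltnW// ltn_expl.
  have [k kn kx] : exists2 k, (k < 2 ^ n)%N & cell n k x.
    by apply: cell_ex; have := AT _ Ax; rewrite /= in_itv.
  exists n => //; apply/UnP; exists k => //; split => //.
  apply/asboolP => y ky; apply: rU; rewrite /ball/=.
  have E : T * k.+1%:R / 2 ^+ n = T * k%:R / 2 ^+ n + T / 2 ^+ n.
    by rewrite -natr1 mulrDr mulr1 mulrDl.
  move: kx ky; rewrite /cell/= !in_itv/= E ltr_distl => /andP[? ?] /andP[? ?].
  by apply/andP; split; lra.
have ndUn : nondecreasing_seq Un.
  apply/nondecreasing_seqP => n; apply/subsetPset => x /UnP[k [kn /asboolP Pk] kx].
  have [k' [k'x k'n] k'k] := cell_split kx.
  apply/UnP; exists k' => //; split; first by rewrite k'n.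
  by apply/asboolP; exact: subset_trans k'k Pk.
have mbU : measurable (\bigcup_n Un n) by exact: bigcup_measurable.
apply: (@le_trans _ _ (lsm (\bigcup_n Un n))).
  by apply: le_measure; [exact: (mem_set mA)|exact: (mem_set mbU)|].
have cU := @nondecreasing_cvg_mu _ _ _ lsm Un mUn mbU ndUn.
rewrite -(cvg_lim _ cU)//; apply: lime_le; first by apply/cvg_ex; eexists; exact: cU.
by apply: nearW => n; exact: lsmUn.
Qed.
(** By [lsm_null] the Stieltjes measure of [h], restricted to ]0, T] where it is finite, is
    dominated by the Lebesgue measure; [rho] is its Radon-Nikodym derivative. *)
Lemma monotone_abs_cont_density : exists2 rho : R -> R,
  lam.-integrable setT (EFin \o rho) &
  forall a b : R, 0 <= a -> a <= b -> b <= T ->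
    (h b - h a)%:E = (\int[lam]_(s in `]a, b]) (rho s)%:E)%E.
Proof.
pose D := `]0, T]%classic : set (measurableTypeR R).
have mD : measurable D by exact: measurable_itv.
have Doo : (lsm D < +oo)%E by rewrite lsm_itv ?ltry// ltW.
pose fnu : {finite_measure set (measurableTypeR R) -> \bar R} := mfrestr mD Doo.
pose nu : {charge set (measurableTypeR R) -> \bar R} := charge_of_finite_measure fnu.
pose mu : {sigma_finite_measure set (measurableTypeR R) -> \bar R} := lam.
have dom : nu `<< mu.
  apply/null_content_dominatesP => A mA A0.
  have mAD : measurable (A `&` D) by exact: measurableI.
  have -> : nu A = lsm (A `&` D) by [].
  apply: lsm_null => //.
  apply/eqP; rewrite -measure_le0 -[leRHS]A0.
  by apply: le_measure; [exact: (mem_set mAD)|exact: (mem_set mA)|exact: subIsetl].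
have fin x := @Radon_Nikodym_fin_num _ _ _ nu mu x dom.
exists (fun x => fine (Radon_Nikodym nu mu x)).
  rewrite (_ : EFin \o _ = Radon_Nikodym nu mu); first exact: Radon_Nikodym_integrable.
  by apply/funext => x /=; rewrite fineK.
move=> a b a0 ab bT.
under eq_integral do rewrite fineK//.
rewrite -(@Radon_Nikodym_integral _ _ _ nu mu)//.
have -> : nu `]a, b]%classic = lsm (`]a, b]%classic `&` D) by [].
rewrite setIidl; last first.
  move=> x; rewrite /D /= !in_itv/= => /andP[ax xb].
  by apply/andP; split; [exact: le_lt_trans ax|exact: le_trans bT].
rewrite lsm_itv// /hc !clipE//; first by rewrite a0 (le_trans ab).
by rewrite bT (le_trans a0).
Qed.

End monotone_abs_cont.

(** * Reduction to monotone functions through the total variation *)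

Section abs_cont_variation.
Context {R : realType}.
Implicit Types (f g : R -> R) (a b : R) (s : seq (R * R)).
Local Notation TV := total_variation.

Let ple (p q : R * R) := p.2 <= q.1.
Let pin a b (p : R * R) := (a <= p.1) && (p.1 <= p.2) && (p.2 <= b).

(** The relation between neighbours is transitive on ordered intervals, so it holds for all pairs;
    in this form it passes to concatenations. *)
Lemma valid_pairsE a b s :
  valid_pairs a b s <-> all (pin a b) s /\ pairwise ple s.
Proof.
rewrite /valid_pairs; split=> -[sab ss]; split => //.
  rewrite -(@sorted_pairwise_in _ (pin a b))//.
  move=> y x z /andP[/andP[_ yy] _] _ _; rewrite /ple => xy yz.
  exact: le_trans xy (le_trans yy yz).
exact: pairwise_sorted.
Qed.

Lemma itv_partition_pairs a b (l : seq R) f : itv_partition a b l ->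
  exists s, [/\ valid_pairs a b s, \sum_(p <- s) (p.2 - p.1) = b - a &
    \sum_(p <- s) `|f p.2 - f p.1| = variation a b f l].
Proof.
(* [zip l (a :: l)] lists right endpoints first, hence the swap. *)
move=> abl; exists [seq (x.2, x.1) | x <- zip l (a :: l)].
rewrite variation_zip// !big_map/=.
suff: [/\ all (pin a b) [seq (x.2, x.1) | x <- zip l (a :: l)],
          pairwise ple [seq (x.2, x.1) | x <- zip l (a :: l)] &
          \sum_(j <- zip l (a :: l)) (j.1 - j.2) = b - a].
  by move=> [? ? ?]; split => //; apply/valid_pairsE; split.
elim: l a abl => [|x l ih] a abl.
  by split => //=; rewrite big_nil (itv_partition_nil abl) subrr.
have xbl := itv_partition_cons abl; have [ihA ihP ihS] := ih _ xbl.
have ax : a <= x by case: abl => /= /andP[/ltW].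
have xb := itv_partition_le xbl.
rewrite [zip _ _]/= big_cons ihS /=; split.
- rewrite /pin/= lexx ax xb/=; apply: sub_all ihA => p.
  by rewrite /pin => /andP[/andP[xp -> ->]]; rewrite (le_trans ax xp).
- rewrite ihP andbT; apply: sub_all ihA => p.
  by rewrite /pin /ple/= => /andP[/andP[]].
- lra.
Qed.

(** The threshold in absolute continuity concerns total length only, and every partition of [x, y]
    has total length y - x. *)
Lemma abs_cont_TV_small a b f : abs_cont a b f ->
  forall e : R, 0 < e -> exists2 d : R, 0 < d &
    forall x y, a <= x -> x <= y -> y <= b -> y - x < d -> (TV x y f <= e%:E)%E.
Proof.
move=> acf e e0; have [d d0 fd] := acf e e0; exists d => // x y ax xy yb yxd.
apply: ge_ereal_sup => _ [_ [l xyl <-] <-]; rewrite lee_fin.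
have [s [/valid_pairsE[sA sP] sL <-]] := itv_partition_pairs f xyl.
apply/ltW/fd; last by rewrite sL.
apply/valid_pairsE; split => //; apply: sub_all sA => p.
move=> /andP[/andP[xp pp] py]; rewrite /pin pp (le_trans ax xp).
by rewrite (le_trans py yb).
Qed.

(** [a, b] is cut into [N] pieces so short that the variation over each is at most 1. *)
Lemma abs_cont_TV_fin a b f : a <= b -> abs_cont a b f ->
  TV a b f \is a fin_num.
Proof.
move=> ab acf; have [d d0 fd] := abs_cont_TV_small acf ltr01.
pose N := (Num.truncn ((b - a) / d)).+1.
have N0 : 0 < N%:R :> R by rewrite ltr0n.
pose r := (b - a) / N%:R.
have r0 : 0 <= r by rewrite divr_ge0 ?subr_ge0// ltW.
have rd : r < d.
  by rewrite ltr_pdivrMr// mulrC -ltr_pdivrMr// truncnS_gt.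
have Nr : N%:R * r = b - a by rewrite /r mulrC divfK ?gt_eqF.
have H k : (k <= N)%N -> (TV a (a + k%:R * r) f <= k%:R%:E)%E.
  elim: k => [|k ih kN]; first by rewrite mul0r addr0 total_variationxx.
  have le1 : a <= a + k%:R * r by rewrite lerDl mulr_ge0.
  have le2 : a + k%:R * r <= a + k.+1%:R * r.
    by rewrite lerD2l ler_wpM2r// ler_nat.
  rewrite (total_variationD f le1 le2) [in leRHS]mulrSr EFinD leeD//; first exact/ih/ltnW.
  apply: fd => //.
    by rewrite -lerBrDl -Nr ler_wpM2r// ler_nat.
  by rewrite (_ : _ - _ = r)// -natr1; ring.
rewrite ge0_fin_numE ?total_variation_ge0//.
have := H N (leqnn _); rewrite Nr subrKC.
by move=> /le_lt_trans; apply; rewrite ltry.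
Qed.

Lemma TV_sub_fin a b f x y : a <= b -> TV a b f \is a fin_num ->
  a <= x -> x <= y -> y <= b -> TV x y f \is a fin_num.
Proof.
move=> ab fin ax xy yb; have ay := le_trans ax xy; have xb := le_trans xy yb.
rewrite ge0_fin_numE ?total_variation_ge0//.
apply: (@le_lt_trans _ _ (TV a b f)); last by rewrite ltey_eq fin.
rewrite (total_variationD f ax xb) (total_variationD f xy yb).
rewrite addeCA leeDl// adde_ge0 ?total_variation_ge0//.
Qed.

(** Each interval is replaced by a partition of it that nearly attains its variation, which
    preserves the total length; the errors e/2, e/4, ... add up to at most e. The bound [lo] moves
    to the right end of the head, so that the refined tail still starts after it. *)
Lemma abs_cont_TV_refine a b f : (forall x y, a <= x -> x <= y -> y <= b ->
    TV x y f \is a fin_num) ->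
  forall s lo, a <= lo -> all (pin lo b) s -> pairwise ple s ->
  forall e : R, 0 < e -> exists s', [/\ all (pin lo b) s', pairwise ple s',
    \sum_(p <- s') (p.2 - p.1) = \sum_(p <- s) (p.2 - p.1) &
    \sum_(p <- s) fine (TV p.1 p.2 f) <= \sum_(p <- s') `|f p.2 - f p.1| + e].
Proof.
move=> fin; elim => [|p s ih] lo alo.
  move=> _ _ e e0; exists [::]; split => //.
  by rewrite !big_nil add0r ltW.
rewrite [all _ _]/= [pairwise _ _]/=.
move=> /andP[/andP[/andP[lop pp] pb] sA] /andP[ps sP] e e0.
have e20 : 0 < e / 2 by rewrite divr_gt0.
have sA' : all (pin p.2 b) s.
  apply/allP => q qs; move: (allP sA _ qs) (allP ps _ qs).
  by rewrite /pin /ple => /andP[/andP[_ -> ->]] ->.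
have [s1 [s1A s1P s1L s1S]] := ih p.2 (le_trans alo (le_trans lop pp)) sA' sP _ e20.
have TVfin := fin _ _ (le_trans alo lop) pp pb.
have [_ [_ [l lp <-] <-] lTV] := ub_ereal_sup_adherent e20 TVfin.
have [s2 [/valid_pairsE[s2A s2P] s2L s2S]] := itv_partition_pairs f lp.
exists (s2 ++ s1); split.
- rewrite all_cat; apply/andP; split.
    apply: sub_all s2A => q /andP[/andP[pq qq] qp].
    by rewrite /pin qq (le_trans lop pq) (le_trans qp pb).
  apply: sub_all s1A => q /andP[/andP[pq qq] qp].
  by rewrite /pin qq qp (le_trans lop (le_trans pp pq)).
- rewrite pairwise_cat s2P s1P !andbT; apply/allrelP => q q' qs q's.
  move: (allP s2A _ qs) (allP s1A _ q's); rewrite /pin /ple.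
  by move=> /andP[_ qp] /andP[/andP[pq _] _]; exact: le_trans qp pq.
- by rewrite big_cat big_cons/= s2L s1L.
- rewrite big_cat big_cons/= s2S.
  move: lTV; rewrite -[X in (X - _)%E]/(TV p.1 p.2 f) -(fineK TVfin).
  by rewrite -EFinB lte_fin; move: s1S; lra.
Qed.

(** Up to e/2, the increments of the variation over a family are increments of [f] over a refined
    family of the same total length, to which the absolute continuity of [f] applies. *)
Lemma abs_cont_TV a b f : a <= b -> abs_cont a b f ->
  abs_cont a b (fun x => fine (TV a x f)).
Proof.
move=> ab acf e e0; have e20 : 0 < e / 2 by rewrite divr_gt0.
have [d d0 fd] := acf _ e20; exists d => // s /valid_pairsE[sA sP] sL.
have fin x y := @TV_sub_fin a b f x y ab (abs_cont_TV_fin ab acf).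
have [s' [s'A s'P s'L s'S]] := abs_cont_TV_refine fin (lexx a) sA sP e20.
have -> : \sum_(p <- s) `|fine (TV a p.2 f) - fine (TV a p.1 f)| =
          \sum_(p <- s) fine (TV p.1 p.2 f).
  apply: eq_big_seq => p /(allP sA) /andP[/andP[ap pp] pb].
  rewrite (total_variationD f ap pp) fineD; last 2 first.
  - by apply: fin => //; exact: le_trans pb.
  - by apply: fin.
  by rewrite addrAC subrr add0r ger0_norm// fine_ge0// total_variation_ge0.
apply: le_lt_trans s'S _; rewrite [ltRHS]splitr ltrD2r.
by apply: fd; [apply/valid_pairsE; split|rewrite s'L].
Qed.

Lemma abs_contB a b f g : abs_cont a b f -> abs_cont a b g ->
  abs_cont a b (fun x => f x - g x).
Proof.
move=> acf acg e e0; have e20 : 0 < e / 2 by rewrite divr_gt0.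
have [d1 d10 fd] := acf _ e20; have [d2 d20 gd] := acg _ e20.
exists (Num.min d1 d2); first by rewrite lt_min d10.
move=> s sv; rewrite lt_min => /andP[/(fd _ sv) sf /(gd _ sv) sg].
apply: le_lt_trans (_ : \sum_(p <- s) (`|f p.2 - f p.1| + `|g p.2 - g p.1|) < e).
  apply: ler_sum => p _; rewrite (_ : _ - _ = (f p.2 - f p.1) - (g p.2 - g p.1)); last lra.
  exact: ler_normB.
by rewrite big_split/= [ltRHS]splitr ltrD.
Qed.

Local Notation lam := (@lebesgue_measure R).

(* Total variation splits f into a difference of monotone absolutely continuous
   functions, whose Stieltjes measures have Radon-Nikodym densities. *)
Theorem abs_cont_density (T : R) f : 0 < T -> abs_cont 0 T f ->
  exists2 rho : R -> R, lam.-integrable setT (EFin \o rho) &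
  forall a b, 0 <= a -> a <= b -> b <= T ->
    (f b - f a)%:E = (\int[lam]_(s in `]a, b]) (rho s)%:E)%E.
Proof.
move=> T0 acf; pose V x := fine (TV 0 x f).
have acV : abs_cont 0 T V by apply: abs_cont_TV => //; exact: ltW.
have fin x y := @TV_sub_fin 0 T f x y (ltW T0) (abs_cont_TV_fin (ltW T0) acf).
have VB x y : 0 <= x -> x <= y -> y <= T -> V y - V x = fine (TV x y f).
  move=> x0 xy yT; rewrite /V (total_variationD f x0 xy) fineD; last 2 first.
  - by apply: fin => //; exact: le_trans yT.
  - exact: fin.
  by rewrite addrAC subrr add0r.
have fV x y : 0 <= x -> x <= y -> y <= T -> `|f y - f x| <= V y - V x.
  move=> x0 xy yT; rewrite VB// -lee_fin fineK; last exact: fin.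
  exact: total_variation_ge.
have [r1 r1i r1E] : exists2 rho : R -> R, lam.-integrable setT (EFin \o rho) &
    forall a b, 0 <= a -> a <= b -> b <= T ->
    (V b - V a)%:E = (\int[lam]_(s in `]a, b]) (rho s)%:E)%E.
  apply: monotone_abs_cont_density => // x y x0 xy yT.
  by rewrite -subr_ge0 (le_trans _ (fV _ _ x0 xy yT)).
have [r2 r2i r2E] : exists2 rho : R -> R, lam.-integrable setT (EFin \o rho) &
    forall a b, 0 <= a -> a <= b -> b <= T ->
    ((V b - f b) - (V a - f a))%:E = (\int[lam]_(s in `]a, b]) (rho s)%:E)%E.
  apply: monotone_abs_cont_density => //; last exact: abs_contB.
  move=> x y x0 xy yT; have := le_trans (ler_norm _) (fV _ _ x0 xy yT); lra.
exists (fun x => r1 x - r2 x).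
  rewrite (_ : _ \o _ = (EFin \o r1) \- (EFin \o r2))%E; last first.
    by apply/funext => x /=; rewrite EFinB.
  exact: integrableB.
move=> a b a0 ab bT.
rewrite (_ : f b - f a = (V b - V a) - (V b - f b - (V a - f a))); last lra.
rewrite EFinB r1E// r2E//; under [RHS]eq_integral do rewrite EFinB.
by rewrite integralB//=; [exact: integrableS r1i|exact: integrableS r2i].
Qed.

(** Lebesgue differentiation of the primitive of [rho], which coincides with [f - f 0] near every
    interior point. *)
Theorem abs_cont_derivable_ae (T : R) f (rho : R -> R) : 0 < T ->
  lam.-integrable setT (EFin \o rho) ->
  (forall a b, 0 <= a -> a <= b -> b <= T ->
    (f b - f a)%:E = (\int[lam]_(s in `]a, b]) (rho s)%:E)%E) ->
  {ae lam, forall x : R, 0 < x < T -> derivable f x 1 /\ derive1 f x = rho x}.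
Proof.
move=> T0 irho rhoE.
have irho' y : lam.-integrable [set` Interval (BRight (0:R)) (BRight y)] (EFin \o rho).
  by apply: integrableS irho => //; exact: measurable_itv.
have lrho : locally_integrable setT rho.
  by apply: open_integrable_locally => //; exact: openT.
have := FTC1 irho' lrho.
apply: filterS; first exact: (ae_filter_ringOfSetsType lam).
move=> x + /andP[x0 xT].
pose FF y := (\int[lam]_(t in `]0%R, y]) rho t)%R.
move=> /(_ _)[|dF F']; first by rewrite -[(_ < _)%E]/(BRight 0%R < BRight x)%O bnd_simp.
rewrite -/FF in dF F'.
have near_fF : \forall y \near x, FF y + f 0 = f y.
  near=> y; rewrite /FF /Rintegral -rhoE/= ?subrK//.
    by apply/ltW; near: y; exact: lt_nbhsr.
  by apply/ltW; near: y; exact: lt_nbhsl.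
have is1 : is_derive x 1 FF (rho x).
  by apply: DeriveDef => //; rewrite -derive1E.
have is2 : is_derive x 1 (fun y => FF y + f 0) (rho x).
  rewrite -[rho x]addr0; exact: is_deriveD.
have is3 := near_eq_is_derive near_fF is2.
by split; [exact: (@ex_derive _ _ _ _ _ _ _ is3)|rewrite derive1E derive_val].
Unshelve. all: by end_near. Qed.
End abs_cont_variation.

(** * Euclidean norm *)

Section euclid.
Context {R : realType} {n : nat}.
Local Notation V := 'rV[R]_n.
Implicit Types (p q v w x y : V) (a : R).

Lemma dotvC p v : dotv p v = dotv v p.
Proof. by apply: eq_bigr => i _; rewrite mulrC. Qed.

Lemma dotvDr p v w : dotv p (v + w) = dotv p v + dotv p w.
Proof. by rewrite /dotv -big_split; apply: eq_bigr => i _; rewrite mxE mulrDr. Qed.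

Lemma dotvZr p a v : dotv p (a *: v) = a * dotv p v.
Proof. by rewrite /dotv big_distrr; apply: eq_bigr => i _; rewrite mxE mulrCA. Qed.

Lemma dotvNr p v : dotv p (- v) = - dotv p v.
Proof. by rewrite -scaleN1r dotvZr mulN1r. Qed.

Lemma dotvBr p v w : dotv p (v - w) = dotv p v - dotv p w.
Proof. by rewrite dotvDr dotvNr. Qed.

Lemma dotvDl p q v : dotv (p + q) v = dotv p v + dotv q v.
Proof. by rewrite !(dotvC _ v) dotvDr. Qed.

Lemma dotvZl a p v : dotv (a *: p) v = a * dotv p v.
Proof. by rewrite !(dotvC _ v) dotvZr. Qed.

Lemma dotvBl p q v : dotv (p - q) v = dotv p v - dotv q v.
Proof. by rewrite !(dotvC _ v) dotvBr. Qed.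

Lemma dotv_ge0 v : 0 <= dotv v v.
Proof. by apply: sumr_ge0 => i _; rewrite -expr2 sqr_ge0. Qed.

Lemma dotv_evec (i : 'I_n) v : dotv (evec i) v = v 0 i.
Proof.
rewrite /dotv (bigD1 i)//= mxE !eqxx mul1r big1 ?addr0// => j ji.
by rewrite mxE eqxx (negbTE ji) mul0r.
Qed.

Lemma enorm_ge0 v : 0 <= enorm v. Proof. exact: sqrtr_ge0. Qed.

Lemma enorm_sqr v : enorm v ^+ 2 = dotv v v.
Proof. by rewrite sqr_sqrtr// dotv_ge0. Qed.

Lemma enorm0 : enorm (0 : V) = 0.
Proof. by rewrite /enorm -(scale0r 0) dotvZr mul0r sqrtr0. Qed.

Lemma enormN v : enorm (- v) = enorm v.
Proof. by rewrite /enorm dotvNr dotvC dotvNr opprK. Qed.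

Lemma enormB v w : enorm (v - w) = enorm (w - v).
Proof. by rewrite -enormN opprB. Qed.

Lemma enormZ a v : enorm (a *: v) = `|a| * enorm v.
Proof.
by rewrite /enorm dotvZr dotvC dotvZr mulrA -expr2 sqrtrM ?sqr_ge0// sqrtr_sqr.
Qed.

Lemma coord_le_enorm v (i : 'I_n) : `|v 0 i| <= enorm v.
Proof.
rewrite -sqrtr_sqr ler_sqrt ?dotv_ge0// /dotv (bigD1 i)//= -expr2 lerDl.
by apply: sumr_ge0 => j _; rewrite -expr2 sqr_ge0.
Qed.

Lemma enorm_eq0 v : (enorm v == 0) = (v == 0).
Proof.
apply/eqP/eqP => [v0|->]; last exact: enorm0.
apply/rowP => i; rewrite mxE; apply/eqP; rewrite -normr_le0 -v0.
exact: coord_le_enorm.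
Qed.

Lemma cauchy_schwarz p v : `|dotv p v| <= enorm p * enorm v.
Proof.
have [->|v0] := eqVneq v 0.
  by rewrite enorm0 mulr0 -(scale0r (0 : V)) dotvZr mul0r normr0.
have c0 : 0 < dotv v v.
  by rewrite -enorm_sqr exprn_gt0// lt_def enorm_eq0 v0 enorm_ge0.
rewrite -(@ler_pXn2r _ 2)// ?nnegrE ?mulr_ge0 ?enorm_ge0//.
rewrite real_normK ?num_real// exprMn !enorm_sqr -ler_pdivrMr//.
have := dotv_ge0 (p - (dotv p v / dotv v v) *: v).
rewrite !(dotvBl, dotvBr, dotvZl, dotvZr) (dotvC v p).
set b := dotv p v; set c := dotv v v.
have -> : dotv p p - b / c * b - b / c * (b - b / c * c) = dotv p p - b ^+ 2 / c.
  by field; rewrite gt_eqF.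
by rewrite subr_ge0.
Qed.

Lemma ler_dotv p v : dotv p v <= enorm p * enorm v.
Proof. exact: le_trans (ler_norm _) (cauchy_schwarz _ _). Qed.

Lemma enormD v w : enorm (v + w) <= enorm v + enorm w.
Proof.
rewrite -(@ler_pXn2r _ 2)// ?nnegrE ?addr_ge0 ?enorm_ge0//.
rewrite sqrrD !enorm_sqr !(dotvDl, dotvDr) (dotvC w v).
by have := ler_dotv v w; lra.
Qed.

Lemma enorm_triangle x y w : enorm (x - w) <= enorm (x - y) + enorm (y - w).
Proof.
have -> : x - w = (x - y) + (y - w) by rewrite subrKA.
exact: enormD.
Qed.

Lemma normv_le_enorm v : `|v| <= enorm v.
Proof.
rewrite [leLHS]mx_normrE bigmax_le ?enorm_ge0//= => -[i j] _ /=.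
by rewrite (ord1 i); exact: coord_le_enorm.
Qed.

Lemma enorm_le_normv v : enorm v <= n%:R * `|v|.
Proof.
rewrite -(@ler_pXn2r _ 2)// ?nnegrE ?mulr_ge0 ?enorm_ge0// enorm_sqr.
have vi (i : 'I_n) : `|v 0 i| <= `|v|.
  by rewrite [leRHS]mx_normrE; exact: (le_bigmax _ (fun ij => `|v ij.1 ij.2|) (0, i)).
apply: (@le_trans _ _ (\sum_(i < n) `|v| ^+ 2)).
  apply: ler_sum => i _; rewrite -expr2 -real_normK ?num_real//.
  by rewrite ler_pXn2r// ?nnegrE.
rewrite sumr_const card_ord -[leLHS]mulr_natl exprMn ler_wpM2r ?sqr_ge0//.
by rewrite -natrX ler_nat; case: (n) => // k; rewrite leq_pmulr.
Qed.

(** This writes the length of a displacement as the increment of a scalar function, to which the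
    scalar fundamental theorem of calculus applies. *)
Lemma enorm_dual v : exists2 e, enorm e <= 1 & dotv e v = enorm v.
Proof.
have [->|v0] := eqVneq v 0.
  by exists 0; rewrite ?enorm0 ?ler01// -(scale0r (0 : V)) dotvZr mul0r.
have c0 : 0 < enorm v by rewrite lt_def enorm_eq0 v0 enorm_ge0.
exists ((enorm v)^-1 *: v).
  by rewrite enormZ ger0_norm ?invr_ge0 ?enorm_ge0// mulVf// gt_eqF.
by rewrite dotvZl -enorm_sqr expr2 mulKf// gt_eqF.
Qed.

Lemma nbhs_enormP x (A : set V) :
  nbhs x A <-> exists2 r : R, 0 < r & ball_e x r `<=` A.
Proof.
split=> [/nbhs_ballP[r /= r0 rA]|[r r0 rA]].
  exists r => // y; rewrite /ball_e/= => yx; apply: rA.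
  by rewrite mx_norm_ball /ball_/= distrC (le_lt_trans (normv_le_enorm _)).
(* The comparison constant between the norms is [n]; its successor keeps the radius meaningful in
   dimension 0. *)
apply/nbhs_ballP; exists (r / n.+1%:R); first by rewrite /= divr_gt0.
move=> y; rewrite mx_norm_ball /ball_/= distrC => yx; apply: rA.
rewrite /ball_e/=; apply: le_lt_trans (enorm_le_normv _) _.
apply: le_lt_trans (_ : n.+1%:R * `|y - x| < r); last first.
  by rewrite mulrC -ltr_pdivlMr.
by rewrite ler_wpM2r// ler_nat.
Qed.

End euclid.

(** * Linear lower bounds for integrals along absolutely continuous curves *)

Section curve_integral.
Context {R : realType} {n : nat}.
Local Notation V := 'rV[R]_n.
Local Notation lam := (@lebesgue_measure R).
Implicit Types (g : R -> V) (q : V).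

Lemma abs_cont_on_dotv a b g q : abs_cont_on a b g ->
  abs_cont a b (fun s => dotv q (g s)).
Proof.
move=> acg e e0; have q1 : 0 < enorm q + 1 by rewrite ltr_wpDl ?enorm_ge0.
have [d d0 gd] := acg (e / (enorm q + 1)) (divr_gt0 e0 q1).
exists d => // s [sA sS] sL; have := gd s sA sS sL.
rewrite ltr_pdivlMr//; apply: le_lt_trans; rewrite mulr_suml.
apply: ler_sum => p _; rewrite -dotvBr; apply: le_trans (cauchy_schwarz _ _) _.
by rewrite mulrC ler_wpM2l ?enorm_ge0// lerDl.
Qed.

Lemma is_derive_dotv g q (s : R) dg : is_derive s 1 g dg ->
  is_derive s 1 (fun r => dotv q (g r)) (dotv q dg).
Proof.
move=> [dgs <-]; have /derivable_mxP dgi := dgs; rewrite derive_mx//.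
have -> : (fun r => dotv q (g r)) = \sum_(i < n) (q 0 i \*: (fun r => g r 0 i)).
  by apply/funext => r; rewrite fct_sumE.
rewrite (_ : dotv _ _ = \sum_(i < n) q 0 i *: 'D_1 (fun r => g r 0 i) s).
  by apply: is_derive_sum => i; apply: is_deriveZ; exact: DeriveDef.
by apply: eq_bigr => i _; rewrite mxE.
Qed.

Lemma derive1_dotv g q (s : R) : derivable g s 1 ->
  derive1 (fun r => dotv q (g r)) s = dotv q (derive1 g s).
Proof.
move=> dg; have [_ E] : is_derive s 1 (fun r => dotv q (g r)) (dotv q ('D_1 g s)).
  by apply: is_derive_dotv; exact: DeriveDef.
by rewrite !derive1E.
Qed.

(** Almost everywhere the minorant equals [- rho - c], with [rho] the density of the scalar function
    [dotv q g]; this function is integrable and integrates to the left-hand side, whereas [l] enters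
    through its lower integral only. *)
Lemma lower_integral_ge_dotv (T a b c K : R) g q (l : R -> R) : 0 < T ->
  abs_cont_on 0 T g -> 0 <= a -> a <= b -> b <= T ->
  (forall s, `[a, b]%classic s -> K <= l s) ->
  (forall s, `]a, b[%classic s -> - dotv q (derive1 g s) - c <= l s) ->
  ((- dotv q (g b - g a) - c * (b - a))%:E <= \int[lam]_(s in `[a, b]) (l s)%:E)%E.
Proof.
move=> T0 acg a0 ab bT Kl ql.
have [rho irho rhoE] := abs_cont_density T0 (abs_cont_on_dotv q acg).
have ae_f := abs_cont_derivable_ae T0 irho rhoE.
(* Derivability of [dotv q g] says nothing about the value [derive1 g s]; all coordinates of [g]
   must be derivable at [s] to identify the two derivatives. *)
have ae_g : {ae lam, forall s : R, 0 < s < T -> derivable g s 1}.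
  have : {ae lam, forall s (i : 'I_n), 0 < s < T -> derivable (fun r => g r 0 i) s 1}.
    apply: (@filter_forall _ _ (fun i s => 0 < s < T -> derivable (fun r => g r 0 i) s 1)
      (almost_everywhere lam) (ae_filter_ringOfSetsType lam)) => i.
    have [r ir rE] := abs_cont_density T0 (abs_cont_on_dotv (evec i) acg).
    have := abs_cont_derivable_ae T0 ir rE.
    apply: filterS; first exact: (ae_filter_ringOfSetsType lam).
    move=> s + sT => /(_ sT)[+ _].
    by rewrite (_ : (fun r => _) = (fun r => g r 0 i))//; apply/funext => r1; rewrite dotv_evec.
  apply: filterS; first exact: (ae_filter_ringOfSetsType lam).
  move=> s gs sT; apply/derivable_mxP => i j.
  by rewrite (ord1 i); exact: gs.
have [N [mN N0 PN]] := @filterI _ _ (ae_filter_ringOfSetsType lam) _ _ ae_f ae_g.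
have {}PN s : a < s < b -> ~ N s -> dotv q (derive1 g s) = rho s.
  move=> /andP[as_ sb] Ns; apply: contrapT => qs; apply: Ns; apply: PN => /=.
  have sT : 0 < s < T by rewrite (le_lt_trans a0)// (lt_le_trans sb).
  by move=> [/(_ sT)[_ fs] /(_ sT) gs]; apply: qs; rewrite -derive1_dotv.
rewrite (@lower_integral_ccE _ _ _ _ K)//.
pose D := `]a, b[%classic : set R.
have mD : measurable D by exact: measurable_itv.
have Doo : (lam D < +oo)%E.
  by apply: (@lebesgue_itv_lty _ _ a b); exact: subset_itv_oo_cc.
have irD : lam.-integrable D (EFin \o rho) by exact: integrableS irho.
have icD : lam.-integrable D (EFin \o cst (- c)).
  apply/integrableP; split; first exact/measurable_EFinP.
  by have /= -> := integral_cst lam mD `|(- c)%:E|%E; rewrite lte_mul_pinfty.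
pose k s := - rho s - c.
have ikD : lam.-integrable D (EFin \o k).
  rewrite (_ : EFin \o k = (-%E \o (EFin \o rho)) \+ (EFin \o cst (- c)%R))%E; last first.
    by apply/funext => s /=.
  by apply: integrableD => //; exact: integrableN.
have -> : (- dotv q (g b - g a) - c * (b - a))%:E = (\int[lam]_(s in D) (k s)%:E)%E.
  under eq_integral do rewrite EFinD.
  have irDN : lam.-integrable D (fun s => (- rho s)%:E) by exact: (integrableN irD).
  rewrite integralD//=.
  have -> : (\int[lam]_(s in D) (- rho s)%:E = - \int[lam]_(s in D) (rho s)%:E)%E.
    under eq_integral do rewrite EFinN.
    by rewrite integralN//; exact: integrable_add_def.
  rewrite integral_itv_bndo_bndc; last by case/integrableP : irD.
  rewrite -rhoE// -dotvBr [X in (_ = _ + X)%E]integral_cst//.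
  rewrite [X in (_ * X)%E]lebesgue_measure_itv/= lte_fin.
  case: ifPn => [_|]; first by rewrite -[RHS]/(- dotv q (g b - g a) + - c * (b - a))%:E mulNr.
  rewrite -leNgt => ba; have -> : a = b by apply/eqP; rewrite eq_le ab ba.
  by rewrite !subrr mulr0 subr0 mule0 adde0.
(* The exceptional set is removed on both sides: by integrability on the left, and on the right
   because a lower integral over a null set vanishes. *)
rewrite (negligible_integral mN mD ikD N0).
have DE : D = (D `\` N) `|` (D `&` N) by rewrite setUC setUIDK.
rewrite [in leRHS](_ : `]a, b[%classic = (D `\` N) `|` (D `&` N))//.
have mDN : measurable (D `&` N) by exact: measurableI.
have mDDN : measurable (D `\` N) by exact: measurableD.
have DN0 : lam (D `&` N) = 0%E.
  apply/eqP; rewrite -measure_le0 -[leRHS]N0.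
  by apply: le_measure; [exact: (mem_set mDN)|exact: (mem_set mN)|exact: subIsetr].
rewrite (@lower_integral_setU _ _ _ lam _ _ _ K)//.
- rewrite [X in (_ <= _ + X)%E]lower_integral_null// adde0.
  apply: le_lower_integral => s [Ds Ns]; rewrite lee_fin /k -PN//.
    exact: ql.
- apply: le_lt_trans Doo.
  by apply: le_measure; [exact: (mem_set mDDN)|exact: (mem_set mD)|exact: subDsetl].
- by rewrite [X in (X < _)%E]DN0 ltry.
- by apply/seteqP; split => // s [[_ Ns] [_ /Ns]].
- move=> s; rewrite -DE => Ds; rewrite lee_fin; apply: Kl.
  exact: subset_itv_oo_cc Ds.
Qed.
End curve_integral.

(** * Supports of measures on curves *)

Section curve_space.
Context {R : realType} {n : nat} (O : set 'rV[R]_n) (T : R).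
Hypothesis T0 : 0 < T.
Local Notation V := 'rV[R]_n.
Implicit Types (g : R -> V) (A : set (R -> V)).

Lemma sup_open_measurable A : @sup_open R n T A ->
  measurable (A : set (CurveSpace R n T)).
Proof. by move=> oA; exact: sub_sigma_algebra. Qed.

Lemma sup_open_eval (B : set V) (t : R) : open B -> 0 <= t <= T ->
  @sup_open R n T [set g | B (g t)].
Proof.
move=> oB tT g /= Bg.
have /nbhs_ballP[r /= r0 rB] : nbhs (g t) B by apply: open_nbhs_nbhs.
exists r => // g' g'g; apply: rB; rewrite mx_norm_ball /ball_/= distrC.
by apply: g'g; rewrite /= in_itv.
Qed.

Lemma closed_pathset_measurable :
  measurable ([set g | forall t, icc 0 T t -> closure O (g t)]
               : set (CurveSpace R n T)).
Proof.
rewrite -[X in measurable X]setCK; apply: measurableC; apply: sup_open_measurable.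
move=> g /= /existsNP[t /not_implyP[tT gt]].
have oC : open (~` closure O) by apply: closed_openC; exact: closed_closure.
have tT' : 0 <= t <= T by move: tT; rewrite /icc /= in_itv.
have [r r0 rO] := sup_open_eval oC tT' gt.
by exists r => // g' /rO gt' /(_ t tT).
Qed.

(** The inequality is not strict, so that violating it is an open condition for uniform convergence;
    with [e] and [d] among the 1/(k+1), countably many such sets describe absolute continuity. *)
Let ac_at (e d : R) g := forall s : seq (R * R), valid_pairs 0 T s ->
  \sum_(p <- s) (p.2 - p.1) < d -> \sum_(p <- s) enorm (g p.2 - g p.1) <= e.

Let ac_at_measurable e d : measurable (ac_at e d : set (CurveSpace R n T)).
Proof.
rewrite -[X in measurable X]setCK; apply: measurableC; apply: sup_open_measurable.
move=> g /= /existsNP[s /not_implyP[sv /not_implyP[sL /negP]]].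
rewrite -ltNge => es.
set S := \sum_(p <- s) _ in es.
(* A perturbation of size [r] moves the two ends of each of the [size s] increments by at most n r
   in Euclidean norm; the added 1 makes [N] positive. *)
pose N : R := (size s)%:R * (2 * n%:R) + 1.
have N0 : 0 < N by rewrite ltr_wpDl// !mulr_ge0.
exists ((S - e) / N); first by rewrite divr_gt0// subr_gt0.
move=> g' g'g /(_ s sv sL); apply/negP; rewrite -ltNge.
set S' := \sum_(p <- s) _.
set r := (S - e) / N in g'g.
have sin p : p \in s -> (`[0, T]%classic p.1) /\ (`[0, T]%classic p.2).
  case: sv => /allP sA _ /sA /andP[/andP[p1 p12] p2] /=; rewrite !in_itv/=.
  by rewrite p1 p2 (le_trans p12 p2) (le_trans p1 p12).
have : S <= S' + \sum_(p <- s) (2 * n%:R * r).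
  rewrite /S /S' -big_split/= [leLHS]big_seq [leRHS]big_seq.
  apply: ler_sum => p /sin[/g'g g1 /g'g g2].
  rewrite (_ : g p.2 - g p.1 =
    (g' p.2 - g' p.1) + ((g' p.1 - g p.1) - (g' p.2 - g p.2))); last first.
    by rewrite opprB addrACA -[LHS]add0r addrA; apply/rowP => i; rewrite !mxE; ring.
  apply: le_trans (enormD _ _) _; rewrite lerD2l.
  apply: le_trans (enormD _ _) _; rewrite enormN mulrDl mul1r mulrDl.
  by apply: lerD; apply: le_trans (enorm_le_normv _) _; apply: ler_wpM2l => //; exact: ltW.
rewrite big_const_seq count_predT iter_addr_0.
have rN : r * N = S - e by rewrite /r divfK// gt_eqF.
have r0 : 0 < r by rewrite /r divr_gt0// subr_gt0.
rewrite -mulr_natl; move: rN; rewrite /N; nra.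
Qed.

Lemma abs_cont_on_bigcap :
  (abs_cont_on 0 T : set (R -> V)) =
  \bigcap_k \bigcup_j ac_at (k.+1%:R^-1) (j.+1%:R^-1).
Proof.
have inv_lt (e : R) : 0 < e -> exists k : nat, k.+1%:R^-1 < e.
  move=> e0; exists (Num.truncn e^-1); rewrite invf_plt ?posrE// truncnS_gt//.
apply/seteqP; split => g.
  move=> acg k _; have [|d d0 gd] := acg k.+1%:R^-1; first by rewrite invr_gt0.
  have [j jd] := inv_lt _ d0; exists j => // s [sA sS] sL.
  by apply/ltW/gd => //; exact: lt_trans jd.
move=> acg e e0; have [k ke] := inv_lt _ e0; have [j _ gj] := acg k I.
exists j.+1%:R^-1; first by rewrite invr_gt0.
by move=> s sA sS sL; apply: le_lt_trans ke; exact: gj.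
Qed.

Lemma Gamma_measurable : measurable (Gamma O T : set (CurveSpace R n T)).
Proof.
rewrite (_ : Gamma O T = (abs_cont_on 0 T : set (R -> V)) `&`
  [set g | forall t, icc 0 T t -> closure O (g t)])//.
apply: measurableI; last exact: closed_pathset_measurable.
rewrite abs_cont_on_bigcap; apply: bigcap_measurable => // k _.
by apply: bigcup_measurable => j _; exact: ac_at_measurable.
Qed.

Lemma abs_cont_on_unif (a b : R) g : abs_cont_on a b g ->
  forall eps : R, 0 < eps -> exists2 delta : R, 0 < delta &
    forall x y : R, a <= x <= b -> a <= y <= b -> `|x - y| < delta ->
      enorm (g x - g y) < eps.
Proof.
move=> acf e e0; have [d d0 fd] := acf e e0; exists d => // x y.
wlog xy : x y / x <= y.
  move=> H xab yab; have [|/ltW] := leP x y; first by move=> xy; exact: H.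
  by move=> yx; rewrite distrC enormB; exact: H.
move=> /andP[ax xb] /andP[ay yb]; rewrite distrC ger0_norm ?subr_ge0// => yxd.
have := fd [:: (x, y)]; rewrite !big_seq1/= enormB; apply => //.
by rewrite ax xy yb.
Qed.

(** The step function with value c_k on [kT/N, (k+1)T/N[. Rational values make the family of these
    functions countable. *)
Definition rat_step (N : nat) (c : seq 'rV[rat]_n) (s : R) : V :=
  map_mx ratr (nth 0 c (Num.truncn (s * N%:R / T))).

Lemma rat_step_dense g : abs_cont_on 0 T g -> forall r : R, 0 < r ->
  exists N c, forall s, `[0, T]%classic s -> `|g s - rat_step N c s| < r.
Proof.
move=> acg r r0; have r20 : 0 < r / 2 by rewrite divr_gt0.
have [d d0 gd] := abs_cont_on_unif acg r20.
pose N := (Num.truncn (T / d)).+1; have N0 : 0 < N%:R :> R by rewrite ltr0n.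
have Nd : T / N%:R < d by rewrite ltr_pdivrMr// mulrC -ltr_pdivrMr// truncnS_gt.
have /choice[phi phiP] (k : nat) : exists v : 'rV[rat]_n,
    `|g (k%:R * T / N%:R) - map_mx ratr v| < r / 2.
  set x := g _.
  have /choice[w wP] (i : 'I_n) : exists q : rat, `|x 0 i - ratr q| < r / 2.
    have [|q] := @rat_in_itvoo _ (x 0 i - r / 2) (x 0 i + r / 2); first by lra.
    by rewrite in_itv/= => /andP[? ?]; exists q; rewrite ltr_norml; apply/andP; split; lra.
  exists (\row_i w i); rewrite [ltLHS]mx_normrE; apply/bigmax_ltP; split => //.
  by move=> [i j] _; rewrite (ord1 i) !mxE.
(* N+1 values are needed, since s = T falls in the cell of index N. *)
exists N, (mkseq phi N.+1) => s /=; rewrite in_itv/= => /andP[s0 sT].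
have sN0 : 0 <= s * N%:R / T by rewrite !mulr_ge0// invr_ge0 ltW.
rewrite /rat_step; set k := Num.truncn _.
have /andP[ks sk] : k%:R <= s * N%:R / T < k.+1%:R by exact: truncn_itv.
have kN : (k <= N)%N.
  by rewrite -(ler_nat R) (le_trans ks)// ler_pdivrMr// mulrC ler_pM2l.
rewrite nth_mkseq//.
have -> : g s - map_mx ratr (phi k) =
    (g s - g (k%:R * T / N%:R)) + (g (k%:R * T / N%:R) - map_mx ratr (phi k)).
  by rewrite subrKA.
rewrite (le_lt_trans (ler_normD _ _))// [ltRHS]splitr ltrD//.
apply: le_lt_trans (normv_le_enorm _) _; apply: gd.
- by rewrite s0.
- rewrite !mulr_ge0 ?invr_ge0 ?(ltW N0) ?(ltW T0)//=.
  by rewrite ler_pdivrMr// mulrC ler_pM2l// ler_nat.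
- rewrite ler_pdivlMr// in ks; rewrite ltr_pdivrMr// in sk.
  rewrite ger0_norm; last by rewrite subr_ge0 ler_pdivrMr.
  apply: lt_trans Nd; rewrite ltrBlDr -mulrDl ltr_pdivlMr//.
  by move: sk; rewrite -natr1; lra.
Qed.

(* The space of all functions R -> R^n is not separable, but Gamma is; this is why
   the union of all null open sets is null up to the complement of Gamma. *)
Lemma curve_supp_meets (eta : probability (CurveSpace R n T) R) A :
  eta (~` Gamma O T) = 0%E -> @sup_open R n T A -> (0 < eta A)%E ->
  exists2 g, curve_supp O T eta g & A g.
Proof.
move=> etaG oA etaA; apply: contrapT => noA.
have null g : Gamma O T g -> A g ->
    exists B, [/\ @sup_open R n T B, B g & eta B = 0%E].
  move=> Gg Ag; apply: contrapT => noB; apply: noA; exists g => //; split => // B oB Bg.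
  rewrite lt_def measure_ge0 andbT; apply/eqP => B0.
  by apply: noB; exists B; split.
pose I := (nat * (nat * seq 'rV[rat]_n))%type.
pose near_step (i : I) g := forall s, `[0, T]%classic s ->
  `|g s - rat_step i.2.1 i.2.2 s| < i.1.+1%:R^-1.
(* Lindelof argument: every rational ball contained in some null open set is assigned one such set,
   and every other code the empty set. *)
have /choice[Z ZP] (k : nat) : exists B : set (R -> V),
    [/\ @sup_open R n T B, eta B = 0%E &
     forall i : I, unpickle k = Some i ->
       (exists B', [/\ @sup_open R n T B', eta B' = 0%E & near_step i `<=` B']) ->
       near_step i `<=` B].
  case: (unpickle k) => [i|]; last first.
    by exists set0; split => //; exact: measure0.
  have [[B [oB B0 iB]]|noB] := pselect (exists B',
      [/\ @sup_open R n T B', eta B' = 0%E & near_step i `<=` B']).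
    by exists B; split => // j [<-].
  by exists set0; split; [move=> g []|exact: measure0|move=> j [<-] /noB].
have AZ : A `<=` ~` Gamma O T `|` \bigcup_k Z k.
  move=> g Ag; have [Gg|] := pselect (Gamma O T g); last by left.
  right; have [B [oB Bg B0]] := null _ Gg Ag.
  have [r r0 rB] := oB _ Bg.
  (* With 1/(j+1) < r/2, a rational ball of this radius that contains [g] lies within distance [r]
     of [g], hence inside [B]. *)
  pose j := Num.truncn (2 / r); have j0 : 0 < j.+1%:R^-1 :> R by rewrite invr_gt0.
  have jr : j.+1%:R^-1 < r / 2 :> R.
    by rewrite invf_plt ?posrE ?divr_gt0// invf_div truncnS_gt.
  have [N [c gc]] := rat_step_dense Gg.1 j0.
  pose i : I := (j, (N, c)).
  exists (pickle i) => //; have [_ _ /(_ i (pickleK _))] := ZP (pickle i).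
  apply; last exact: gc.
  exists B; split => // g' g'i; apply: rB => s sT.
  rewrite -(subrKA (rat_step N c s)) (le_lt_trans (ler_normD _ _))// (splitr r).
  by rewrite ltrD// (lt_trans _ jr)//; [exact: g'i|rewrite distrC; exact: gc].
have : eta A = 0%E.
  apply: measure_negligible; first exact: sup_open_measurable.
  apply: (@negligibleS _ (CurveSpace R n T) R eta _ _ AZ); apply: negligibleU.
    apply/negligibleP => //; apply: measurableC; exact: Gamma_measurable.
  apply: negligible_bigcup => k; have [oZ Z0 _] := ZP k.
  by apply/negligibleP => //; exact: sup_open_measurable.
by move=> A0; rewrite A0 ltxx in etaA.
Qed.

Lemma is_flow_unique (eta : probability (CurveSpace R n T) R) (m m' : R -> PV R n) t :
  is_flow T eta m -> is_flow T eta m' -> icc 0 T t ->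
  forall A : set (BorelV R n), measurable A -> m t A = m' t A.
Proof. by move=> fm fm' tT A mA; rewrite fm// fm'. Qed.

Lemma d1_eq0 (m1 m2 : PV R n) :
  (forall A : set (BorelV R n), measurable A -> m1 A = m2 A) -> d1 O m1 m2 = 0%E.
Proof.
move=> m12; apply/eqP; rewrite eq_le; apply/andP; split.
  apply: ge_ereal_sup => _ [f _ <-].
  rewrite (eq_measure_integral m2); last by move=> A mA _; exact: m12.
  (* By convention both [+oo - +oo] and [-oo - -oo] equal [-oo], which respects the bound 0. *)
  by case: (integral _ _ _) => [r| |]; [rewrite subee|exact: leNye|exact: leNye].
apply: ereal_sup_ubound; exists (cst 0).
  by move=> x y _ _; rewrite subrr normr0 enorm_ge0.
by rewrite !integral0 subee.
Qed.

End curve_space.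

(** * Estimates on the Lagrangian and the coupling *)

Section directional.
Context {R : realType}.

Lemma is_derive_line {W W' : normedModType R} (f : W -> W') (z w : W) (s : R) :
  differentiable f (z + s *: w) ->
  is_derive s 1 (fun r : R => f (z + r *: w)) ('d f (z + s *: w) w).
Proof.
move=> df; have := @diff_derivable _ _ _ f _ w df; rewrite -deriveE//.
have E : (fun h : R => h^-1 *: (f (z + (h *: (1 : R) + s) *: w) - f (z + s *: w))) =
         (fun h : R => h^-1 *: (f (h *: w + (z + s *: w)) - f (z + s *: w))).
  apply/funext => h; congr (_ *: (f _ - _)).
  by rewrite [h *: 1]mulr1 scalerDl addrCA.
move=> dfw; apply: DeriveDef; first by rewrite /derivable E.
by rewrite /derive E.
Qed.

Lemma MVT_derive (f df : R -> R) (b : R) : 0 < b ->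
  (forall s, 0 <= s <= b -> is_derive s 1 f (df s)) ->
  exists2 c, 0 < c < b & f b - f 0 = df c * b.
Proof.
move=> b0 fdf; have [|||c cb ->] := @MVT _ f df 0 b.
- by [].
- by move=> s; rewrite in_itv/= => /andP[/ltW s0 /ltW sb]; apply: fdf; rewrite s0.
- apply: derivable_within_continuous => s; rewrite in_itv/= => sb.
  exact: (@ex_derive _ _ _ _ _ _ _ (fdf _ sb)).
- by exists c => //; rewrite subr0.
Qed.

End directional.

Section lagrangian.
Context {R : realType} {n : nat} (U : set 'rV[R]_n).
Context (L : 'rV[R]_n -> 'rV[R]_n -> R) (M mu : R).
Hypotheses (mu0 : 0 < mu) (HL : assum_L U L M mu).
Local Notation V := 'rV[R]_n.
Implicit Types (x y v w : V).

Lemma row_sum_evec v : v = \sum_i v 0 i *: evec i.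
Proof. exact: row_sum_delta. Qed.

Let LJ_diff y v : U y -> differentiable (LJ L) (y, v).
Proof. by move=> Uy; case: HL => -[[dL _] _] _ _ _; apply: dL; split. Qed.

Let dLJ_v y v w : U y -> 'd (LJ L) (y, v) (0, w) = dotv (DvL L y v) w.
Proof.
move=> Uy; rewrite {1}(row_sum_evec w).
have -> : ((0, \sum_i w 0 i *: evec i) : V * V) = \sum_i w 0 i *: ((0, evec i) : V * V).
  elim/big_ind2: _ => // [a b c d <- <-|i _]; first by rewrite /GRing.add/= /add_pair/= addr0.
  by rewrite /GRing.scale/= /scale_pair/= scaler0.
rewrite linear_sum; apply: eq_bigr => i _.
by rewrite linearZ mxE mulrC.
Qed.

Let dLJ_x y v w : U y -> 'd (LJ L) (y, v) (w, 0) = dotv (DxL L y v) w.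
Proof.
move=> Uy; rewrite {1}(row_sum_evec w).
have -> : ((\sum_i w 0 i *: evec i, 0) : V * V) = \sum_i w 0 i *: ((evec i, 0) : V * V).
  elim/big_ind2: _ => // [a b c d <- <-|i _]; first by rewrite /GRing.add/= /add_pair/= addr0.
  by rewrite /GRing.scale/= /scale_pair/= scaler0.
rewrite linear_sum; apply: eq_bigr => i _.
by rewrite linearZ mxE mulrC.
Qed.

Lemma sum3_le (a b c d : R) : 0 <= a -> 0 <= b -> 0 <= c -> a + b + c <= d ->
  [/\ a <= d, b <= d & c <= d].
Proof. by move=> *; split; lra. Qed.

Lemma L_bounds y : U y ->
  [/\ `|L y 0| <= M, enorm (DxL L y 0) <= M & enorm (DvL L y 0) <= M].
Proof.
case: HL => -[_ LM] _ _ _ /LM.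
by apply: sum3_le; rewrite ?normr_ge0 ?enorm_ge0.
Qed.

(** Second-order Taylor bound at v = 0 along s -> s v: the derivative [psi] grows at rate at least
    |v|^2 / mu, and (L0) controls the value and the slope at 0. *)
Lemma L_lower_bound y v : U y ->
  enorm v ^+ 2 / (2 * mu) - M * enorm v - M <= L y v.
Proof.
move=> Uy; pose c := enorm v ^+ 2 / mu.
pose psi (s : R) := dotv (DvL L y (s *: v)) v.
have vE (s : R) : ((y, 0) : V * V) + s *: ((0, v) : V * V) = (y, s *: v).
  by rewrite -[LHS]/(y + s *: 0, 0 + s *: v) scaler0 addr0 add0r.
have dpsi (s : R) : is_derive s 1 psi (dotv ('d (DvLJ L) (y, s *: v) (0, v)) v).
  have dd : differentiable (DvLJ L) ((y, 0) + s *: ((0, v) : V * V)).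
    by rewrite vE; case: HL => _ [+ _] _ _; apply; split.
  have := is_derive_dotv v (is_derive_line dd); rewrite vE dotvC.
  by under eq_fun do rewrite vE dotvC.
have dphi (s : R) : is_derive s 1 (fun r : R => L y (r *: v)) (psi s).
  have dd : differentiable (LJ L) ((y, 0) + s *: ((0, v) : V * V)).
    by rewrite vE; exact: LJ_diff.
  have := is_derive_line dd; rewrite vE dLJ_v//.
  by under eq_fun do rewrite vE.
have psi_lb (s : R) : 0 <= s -> psi 0 + c * s <= psi s.
  rewrite le_eqVlt => /predU1P[<-|s0]; first by rewrite mulr0 addr0.
  have [xi _ E] := MVT_derive s0 (fun r _ => dpsi r).
  rewrite -lerBrDl E ler_pM2r// /c.
  by case: HL => _ [_ /(_ y (xi *: v) v Uy)[/andP[]]].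
(* The subtracted polynomial has as derivative the minorant of [psi], so [chi] has nonnegative
   derivative on ]0, 1[. *)
pose chi (s : R) := L y (s *: v) - (psi 0 * s + c / 2 * s ^+ 2).
have dchi (s : R) : is_derive s 1 chi (psi s - (psi 0 + c * s)).
  apply: is_deriveB.
  rewrite (_ : (fun r => _) = (psi 0 \*: id) + ((c / 2) \*: (fun r : R => r ^+ 2)))//.
  apply: is_derive_eq.
  by rewrite /GRing.scale/= !mulr1; lra.
have [xi /andP[xi0 _] E] := MVT_derive ltr01 (fun r _ => dchi r).
have chi01 : chi 0 <= chi 1.
  by rewrite -subr_ge0 E mulr1 subr_ge0 psi_lb// ltW.
move: chi01; rewrite /chi scale1r scale0r mulr1 expr1n mulr1 mulr0 expr0n/= mulr0 addr0 subr0 => H.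
have [LM DM] : `|L y 0| <= M /\ enorm (DvL L y 0) <= M.
  by have [? _ ?] := L_bounds Uy.
have p0 : - (M * enorm v) <= psi 0.
  have := cauchy_schwarz (DvL L y 0) v; rewrite /psi scale0r ler_norml => /andP[+ _].
  by apply: le_trans; rewrite lerN2 ler_wpM2r ?enorm_ge0.
have cE : c / 2 = enorm v ^+ 2 / (2 * mu) by rewrite /c invfM mulrA mulrAC.
move: LM; rewrite ler_norml -cE => /andP[LM _].
apply: le_trans (_ : L y 0 + (psi 0 + c / 2) <= _); last by rewrite -lerBrDr.
by rewrite addrCA addrC addrAC addrC -addrA lerD// addrC lerD.
Qed.

Lemma L_superlinear (K : R) : exists C : R, forall y v, U y ->
  K * enorm v - C <= L y v.
Proof.
(* Completing the square: |v|^2 / (2 mu) - (K + M)|v| is at least - (K + M)^2 mu / 2. *)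
exists ((K + M) ^+ 2 * mu / 2 + M) => y v Uy.
apply: le_trans (L_lower_bound v Uy).
have : 0 <= (enorm v - (K + M) * mu) ^+ 2 / (2 * mu).
  by rewrite mulr_ge0 ?sqr_ge0// invr_ge0 mulr_ge0// ltW.
rewrite (_ : _ / _ = enorm v ^+ 2 / (2 * mu) - (K + M) * enorm v + (K + M) ^+ 2 * mu / 2).
  lra.
by field; rewrite gt_eqF.
Qed.

(** On the ball, D_xL is at most M at v = 0 by (L0) and changes by at most C|v| by (L2); the segment
    from x to y stays in the ball, hence in [U]. *)
Lemma L_lipschitz x (r Rr : R) : 0 <= Rr -> ball_e x r `<=` U ->
  exists2 C : R, 0 <= C & forall y v, enorm (y - x) < r -> enorm v <= Rr ->
    `|L y v - L x v| <= C * enorm (y - x).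
Proof.
move=> R0 rU; case: (HL) => _ _ /(_ Rr)[C CP] _.
exists (`|M| + `|C| * Rr); first by rewrite addr_ge0// mulr_ge0.
move=> y v yx vR.
have zE (s : R) : ((x, v) : V * V) + s *: ((y - x, 0) : V * V) = (x + s *: (y - x), v).
  by rewrite -[LHS]/(x + s *: (y - x), v + s *: 0) scaler0 addr0.
have Uz (s : R) : 0 <= s <= 1 -> U (x + s *: (y - x)).
  move=> /andP[s0 s1]; apply: rU; rewrite /ball_e/= addrAC subrr add0r enormZ ger0_norm//.
  by apply: le_lt_trans yx; rewrite ler_piMl ?enorm_ge0.
have dphi (s : R) : 0 <= s <= 1 -> is_derive s 1 (fun r : R => L (x + r *: (y - x)) v)
    (dotv (DxL L (x + s *: (y - x)) v) (y - x)).
  move=> s01; have dd : differentiable (LJ L) ((x, v) + s *: ((y - x, 0) : V * V)).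
    by rewrite zE; apply: LJ_diff; exact: Uz.
  have := is_derive_line dd; rewrite zE dLJ_x//; last exact: Uz.
  by under eq_fun do rewrite zE.
have [xi /andP[/ltW xi0 /ltW xi1]] := MVT_derive ltr01 dphi.
rewrite scale1r scale0r addr0 subrKC mulr1 => ->.
apply: le_trans (cauchy_schwarz _ _) _; rewrite ler_wpM2r ?enorm_ge0//.
set z := x + xi *: (y - x); have zU : U z by apply: Uz; rewrite xi0.
have -> : DxL L z v = DxL L z 0 + (DxL L z v - DxL L z 0) by rewrite subrKC.
apply: le_trans (enormD _ _) _; apply: lerD.
  by have [_ + _] := L_bounds zU; move/le_trans; apply; exact: ler_norm.
apply: le_trans (CP _ _ _ zU vR _) _; first by rewrite enorm0.
rewrite subr0; apply: le_trans (_ : `|C| * enorm v <= _).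
  by rewrite ler_wpM2r ?enorm_ge0// ler_norm.
by rewrite ler_wpM2l.
Qed.

End lagrangian.

Section coupling.
Context {R : realType} {n : nat} (O U : set 'rV[R]_n) (T : R).
Context (F G : 'rV[R]_n -> PV R n -> R) (kappa : R) (m : R -> PV R n).
Hypotheses (HF : assum_FG O U F G kappa)
  (inPm : forall t, icc 0 T t -> inP O (m t))
  (cont_m : forall t, icc 0 T t -> forall eps : R, 0 < eps ->
     exists2 delta : R, 0 < delta &
     forall s, icc 0 T s -> `|s - t| < delta -> (d1 O (m s) (m t) < eps%:E)%E).
Local Notation V := 'rV[R]_n.
Implicit Types (x y : V).

Let kappa_ge0 y t : U y -> icc 0 T t -> 0 <= kappa.
Proof.
move=> Uy /inPm mt; case: HF => _ /(_ _ mt)[_ _ _ /(_ y Uy)] + _.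
by apply: le_trans; rewrite addr_ge0 ?enorm_ge0.
Qed.

(** The modulus is independent of [y], as (D1) is uniform in the point. *)
Lemma F_time_continuous t : icc 0 T t -> forall eps : R, 0 < eps ->
  exists2 delta : R, 0 < delta & forall s y, icc 0 T s -> U y ->
    `|s - t| < delta -> `|F y (m s) - F y (m t)| < eps.
Proof.
move=> tT e e0; have k0 : 0 < `|kappa| + 1 by rewrite ltr_wpDl.
have [d d0 md] := cont_m tT (divr_gt0 e0 k0).
exists d => // s y sT Uy st.
have kge0 := kappa_ge0 Uy tT.
have [/(_ y (m s) (m t) Uy (inPm sT) (inPm tT)) H _ _] := HF.
rewrite -lte_fin; apply: (@le_lt_trans _ _ (kappa%:E * (e / (`|kappa| + 1))%:E)%E).
  apply: le_trans (_ : (kappa%:E * d1 O (m s) (m t) <= _)%E); last first.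
    by apply: lee_wpmul2l; [rewrite lee_fin|exact/ltW/md].
  by apply: le_trans H; rewrite lee_fin lerDl.
rewrite -EFinM lte_fin mulrCA gtr_pMr// ltr_pdivrMr// mul1r.
by rewrite ger0_norm// ltrDl.
Qed.

Lemma F_continuous t x : icc 0 T t -> U x -> forall eps : R, 0 < eps ->
  exists2 delta : R, 0 < delta & forall s y, icc 0 T s -> U y ->
    `|s - t| < delta -> enorm (y - x) < delta -> `|F y (m s) - F x (m t)| < eps.
Proof.
move=> tT Ux e e0; have e20 : 0 < e / 2 by rewrite divr_gt0.
have [d1 d10 Fd1] := F_time_continuous tT e20.
have cF : {for x, continuous (F^~ (m t))}.
  apply: differentiable_continuous.
  by case: HF => _ /(_ _ (inPm tT))[[+ _] _ _ _] _; exact.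
have [d2 d20 Fd2] := (nbhs_enormP _ _).1 ((cvgrPdist_lt _ _).1 cF _ e20).
exists (Num.min d1 d2); first by rewrite lt_min d10.
move=> s y sT Uy; rewrite !lt_min => /andP[st _] /andP[_ yx].
have -> : F y (m s) - F x (m t) = (F y (m s) - F y (m t)) + (F y (m t) - F x (m t)).
  by rewrite subrKA.
rewrite (le_lt_trans (ler_normD _ _))// [ltRHS]splitr ltrD//; first exact: Fd1.
by rewrite distrC; exact: Fd2.
Qed.

(** (D2) bounds F(., m) for each measure separately; compactness of [0, T] and the uniform
    continuity in time give one constant along the flow. *)
Lemma F_bounded : exists C : R, forall s y, icc 0 T s -> U y -> `|F y (m s)| <= C.
Proof.
pose P (C : R) (s : R) := forall y, U y -> `|F y (m s)| <= C.
have /compact_near_coveringP/near_covering_withinP cov := @segment_compact R 0 T.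
have [] := cov R (+oo) P _.
  move=> t tT.
  have [d d0 Fd] := F_time_continuous tT ltr01.
  have [C CP] : exists C : R, forall y, U y -> `|F y (m t)| <= C.
    case: HF => _ /(_ _ (inPm tT))[_ _ [C CP] _] _.
    by exists C => y /CP[].
  exists (ball t d, [set C' | C + 1 < C']).
    by split; [exact: nbhsx_ballx|exists (C + 1); split => //; exact: num_real].
  move=> -[s C'] /= [st CC'] sT y Uy; apply: ltW; apply: le_lt_trans CC'.
  rewrite -(subrK (F y (m t)) (F y (m s))) (le_trans (ler_normD _ _))// addrC.
  rewrite lerD ?CP//; apply/ltW/Fd => //; rewrite distrC.
  exact: st.
move=> C [_ CP]; exists (C + 1) => s y sT Uy.
by apply: CP => //; rewrite ltrDl.
Qed.

End coupling.

(** * Dynamic programming *)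

Section curve_gluing.
Context {R : realType} {n : nat}.
Local Notation V := 'rV[R]_n.
Implicit Types (g : R -> V) (a b t : R).

Lemma lipschitz_abs_cont_on a b g (C : R) :
  (forall s r, a <= s -> s <= r -> r <= b -> enorm (g r - g s) <= C * (r - s)) ->
  abs_cont_on a b g.
Proof.
move=> gC e e0; have C0 : 0 < `|C| + 1 by rewrite ltr_wpDl.
exists (e / (`|C| + 1)); first by rewrite divr_gt0.
move=> s sA _; rewrite ltr_pdivlMr// mulr_suml; apply: le_lt_trans.
rewrite big_seq [leRHS]big_seq; apply: ler_sum => p /(allP sA) /andP[/andP[ap pp] pb].
apply: le_trans (gC _ _ ap pp pb) _; rewrite mulrC ler_wpM2l ?subr_ge0//.
by rewrite (le_trans (ler_norm _))// lerDl.
Qed.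

Definition glue_curve t g1 g2 (s : R) : V := if s <= t then g1 s else g2 s.

(** Each family of intervals is cut at [t] into a left and a right family, neither of larger total
    length; an interval straddling [t] is treated by the triangle inequality through the common
    value. *)
Lemma glue_abs_cont_on a b t g1 g2 : a <= t <= b -> g1 t = g2 t ->
  abs_cont_on a b g1 -> abs_cont_on a b g2 -> abs_cont_on a b (glue_curve t g1 g2).
Proof.
move=> /andP[a_t tb] g12 ac1 ac2 e e0; have e20 : 0 < e / 2 by rewrite divr_gt0.
have [d1 d10 gd1] := ac1 _ e20; have [d2 d20 gd2] := ac2 _ e20.
exists (Num.min d1 d2); first by rewrite lt_min d10.
move=> s sA sS; rewrite lt_min => /andP[sd1 sd2].
pose cl (p : R * R) := (Num.min p.1 t, Num.min p.2 t).
pose cr (p : R * R) := (Num.max p.1 t, Num.max p.2 t).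
apply: (@le_lt_trans _ _ (\sum_(p <- map cl s) enorm (g1 p.2 - g1 p.1) +
                          \sum_(p <- map cr s) enorm (g2 p.2 - g2 p.1))).
  rewrite !big_map -big_split/= big_seq [leRHS]big_seq.
  apply: ler_sum => p /(allP sA) /andP[/andP[ap pp] pb]; rewrite /glue_curve.
  case: (leP p.1 t) => p1t; case: (leP p.2 t) => p2t.
  - by rewrite lerDl enorm_ge0.
  - by rewrite addrC g12; exact: enorm_triangle.
  - by move: (lt_le_trans p1t pp); rewrite ltNge p2t.
  - by rewrite lerDr enorm_ge0.
rewrite [ltRHS]splitr; apply: ltrD.
- apply: gd1.
  + apply/allP => _ /mapP[p /(allP sA) /andP[/andP[ap pp] pb] ->] /=.
    by rewrite !le_min !ge_min ap a_t pp pb lexx !orbT.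
  + rewrite sorted_map; apply: sub_sorted sS => p q /=.
    by rewrite le_min !ge_min lexx orbT => ->.
  + apply: le_lt_trans sd1; rewrite big_map big_seq [leRHS]big_seq.
    apply: ler_sum => p /(allP sA) /andP[/andP[ap pp] pb] /=.
    by rewrite /Num.min; do 2 case: ifPn; rewrite -?leNgt => *; lra.
- apply: gd2.
  + apply/allP => _ /mapP[p /(allP sA) /andP[/andP[ap pp] pb] ->] /=.
    by rewrite !ge_max !le_max ap tb pp pb lexx !orbT.
  + rewrite sorted_map; apply: sub_sorted sS => p q /=.
    by rewrite ge_max !le_max lexx orbT => ->.
  + apply: le_lt_trans sd2; rewrite big_map big_seq [leRHS]big_seq.
    apply: ler_sum => p /(allP sA) /andP[/andP[ap pp] pb] /=.
    by rewrite /Num.max; do 2 case: ifPn; rewrite -?leNgt => *; lra.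
Qed.

Lemma glue_Gamma (O : set V) (T : R) t g1 g2 : 0 <= t <= T -> g1 t = g2 t ->
  Gamma O T g1 -> Gamma O T g2 -> Gamma O T (glue_curve t g1 g2).
Proof.
move=> tT g12 [ac1 O1] [ac2 O2]; split; first exact: glue_abs_cont_on.
by move=> s sT; rewrite /glue_curve; case: ifP => _; [exact: O1|exact: O2].
Qed.

Lemma derive1_near (g1 g2 : R -> V) (s : R) :
  (\forall r \near s, g1 r = g2 r) -> derive1 g1 s = derive1 g2 s.
Proof. by move=> g12; rewrite !derive1E; exact: near_eq_derive. Qed.

Lemma derive1_glue_l t g1 g2 s : s < t ->
  derive1 (glue_curve t g1 g2) s = derive1 g1 s.
Proof.
move=> st; apply: derive1_near; near=> r; rewrite /glue_curve ifT//.
by apply: ltW; near: r; exact: lt_nbhsl.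
Unshelve. all: by end_near. Qed.

Lemma derive1_glue_r t g1 g2 s : t < s ->
  derive1 (glue_curve t g1 g2) s = derive1 g2 s.
Proof.
move=> st; apply: derive1_near; near=> r; rewrite /glue_curve ifF//.
by apply/negbTE; rewrite -ltNge; near: r; exact: lt_nbhsr.
Unshelve. all: by end_near. Qed.

End curve_gluing.

Section cost_theory.
Context {R : realType} {n : nat} (O : set 'rV[R]_n) (T : R).
Context (L : 'rV[R]_n -> 'rV[R]_n -> R) (F G : 'rV[R]_n -> PV R n -> R)
  (m : R -> PV R n) (K : R).
Local Notation V := 'rV[R]_n.
Local Notation lam := (@lebesgue_measure R).
Implicit Types (g : R -> V) (s t r : R).

Definition running g s : R := L (g s) (derive1 g s) + F (g s) (m s).

Hypothesis T0 : 0 < T.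
Hypothesis running_ge : forall g s, Gamma O T g -> 0 <= s <= T -> K <= running g s.

Let running_ge' g a b s : Gamma O T g -> 0 <= a -> b <= T ->
  `[a, b]%classic s -> K <= running g s.
Proof.
move=> Gg a0 bT; rewrite /= in_itv/= => /andP[as_ sb]; apply: running_ge => //.
by rewrite (le_trans a0 as_) (le_trans sb bT).
Qed.

Lemma cost_glue t r g1 g2 : 0 <= t -> t <= r -> r <= T -> g1 r = g2 r ->
  Gamma O T g1 -> Gamma O T g2 ->
  cost L F G m T t (glue_curve r g1 g2) =
  (\int[lam]_(s in `[t, r]) (running g1 s)%:E + cost L F G m T r g2)%E.
Proof.
move=> t0 tr rT g12 G1 G2; have r0 := le_trans t0 tr.
have Gg : Gamma O T (glue_curve r g1 g2) by apply: glue_Gamma => //; rewrite r0.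
rewrite /cost.
rewrite -[X in (X + _)%E]/(\int[lam]_(s in `[t, T]) (running (glue_curve r g1 g2) s)%:E)%E.
rewrite (@lower_integral_cat _ _ t T r K); last 2 first.
- by rewrite tr.
- by move=> s; exact: running_ge'.
rewrite -addeA; congr (_ + (_ + _))%E.
- apply: (@eq_lower_integral _ _ _ _ _ K) => [s|s|s /=]; [exact: running_ge'..|].
  rewrite in_itv/= => /andP[_ sr].
  by rewrite /running derive1_glue_l// /glue_curve ltW.
- apply: (@eq_lower_integral _ _ _ _ _ K) => [s|s|s /=]; [exact: running_ge'..|].
  rewrite in_itv/= => /andP[rs _].
  by rewrite /running derive1_glue_r// /glue_curve leNgt rs.
(* If r = T the glued curve ends on [g1], but the two curves agree there. *)
- rewrite /glue_curve; case: ifPn => // Tr.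
  by have <- : r = T by [apply/eqP; rewrite eq_le rT Tr]; rewrite g12.
Qed.

Lemma glue_id t g : glue_curve t g g = g.
Proof. by apply/funext => s; rewrite /glue_curve; case: ifP. Qed.

Lemma cost_split t r g : 0 <= t -> t <= r -> r <= T -> Gamma O T g ->
  cost L F G m T t g =
  (\int[lam]_(s in `[t, r]) (running g s)%:E + cost L F G m T r g)%E.
Proof. by move=> t0 tr rT Gg; rewrite -[in LHS](glue_id r g) cost_glue. Qed.

Lemma cost_gtNy t g : 0 <= t <= T -> Gamma O T g -> (-oo < cost L F G m T t g)%E.
Proof.
move=> /andP[t0 tT] Gg; rewrite /cost.
apply: lt_le_trans (_ : ((K * (T - t))%:E + (G (g T) (m T))%:E <= _)%E).
  by rewrite -EFinD ltNyr.
rewrite leeD2r//; apply: lower_integral_ge_cst => // s.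
exact: running_ge'.
Qed.

Lemma cst_Gamma x : closure O x -> Gamma O T (cst x).
Proof.
move=> Ox; split => //; apply: (@lipschitz_abs_cont_on _ _ _ _ _ 0) => s r _ _ _.
by rewrite /= subrr enorm0 mul0r.
Qed.

Lemma cost_cst_lty x (C : R) : closure O x ->
  (forall s, 0 <= s <= T -> F x (m s) <= C) -> (cost L F G m T 0 (cst x) < +oo)%E.
Proof.
move=> Ox FC; rewrite /cost.
apply: (@le_lt_trans _ _ (((L x 0 + C) * (T - 0))%:E + (G x (m T))%:E)%E); last first.
  by rewrite -EFinD ltry.
rewrite leeD2r//; apply: (@lower_integral_le_cst _ _ _ _ _ K); first exact: ltW.
- by move=> s; apply: (@running_ge' (cst x)) => //; exact: cst_Gamma.
- move=> s /=; rewrite in_itv/= derive1_cst lerD2l => /andP[/ltW s0 /ltW sT].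
  by apply: FC; rewrite s0.
Qed.

(* Bellman's principle *)
Lemma minimizer_tail x g r (C : R) : minimizers O L F G m T x g ->
  (forall s, 0 <= s <= T -> F x (m s) <= C) -> 0 <= r <= T ->
  forall g', Gamma O T g' -> g' r = g r ->
  (cost L F G m T r g <= cost L F G m T r g')%E.
Proof.
move=> [Gg g0 gmin] FC /andP[r0 rT] g' Gg' gr.
have Ox : closure O x by rewrite -g0; apply: Gg.2; rewrite /icc /= in_itv/= lexx ltW.
(* Comparison with the curve resting at [x] makes the optimal cost finite, so that the common
   integral over [0, r] can be cancelled. *)
have cfin : (cost L F G m T 0 g < +oo)%E.
  by apply: le_lt_trans (cost_cst_lty Ox FC); apply: gmin => //; exact: cst_Gamma.
have rT' : 0 <= r <= T by rewrite r0.
move: cfin (gmin (glue_curve r g g')); rewrite (cost_split (lexx 0) r0 rT Gg).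
rewrite (cost_glue (lexx 0) r0 rT (esym gr) Gg Gg').
set I := (\int[lam]_(s in _) _)%E.
have Iny : (-oo < I)%E.
  apply: lt_le_trans (lower_integral_ge_cst r0 _); last first.
    by move=> s; apply: (running_ge' Gg).
  by rewrite ltNyr.
have cny := cost_gtNy rT' Gg.
move=> cfin /(_ (glue_Gamma rT' (esym gr) Gg Gg')).
rewrite {1}/glue_curve r0 => /(_ g0).
have Ifin : I \is a fin_num.
  rewrite fin_numElt Iny/=; move: cfin cny.
  by case: (I) => [i| |]; case: (cost _ _ _ _ _ _ _) => [c| |]; rewrite ?ltry.
by rewrite leeD2lE.
Qed.

End cost_theory.

(** * Real inequalities behind the main estimates *)

Lemma superdiff_arith {R : realFieldType} (a b e h l f p q w : R) :
  a - (l + f + 2 * e) * h <= b ->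
  b - a - p * h - h * q <= e * (h + h * w) ->
  0 <= h * (l + f + p + q + (3 + w) * e).
Proof. by nra. Qed.

Lemma quarter_half {R : realFieldType} (d : R) : d / 4 + d / 4 <= d / 2.
Proof. by lra. Qed.

Lemma quarter_half_le {R : realFieldType} (d : R) : 0 <= d -> d / 4 + d / 2 <= d.
Proof. by lra. Qed.

Lemma value_arith1 {R : realFieldType} (T s k a b c : R) : - k <= c ->
  0 <= a -> 0 <= b -> 0 <= c -> 0 <= T - s -> T - s <= T ->
  - ((a + b + c) * T) <= k * (T - s).
Proof. by nra. Qed.

Lemma value_arith2 {R : realFieldType} (T s a b a' b' c : R) : a <= a' -> b <= b' ->
  0 <= a' -> 0 <= b' -> 0 <= c -> 0 <= T - s -> T - s <= T ->
  (a + b) * (T - s) <= (a' + b' + c) * T.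
Proof. by nra. Qed.

Lemma equicont_arith {R : realFieldType} (N w k a b B : R) :
  - (- N * w) - k <= a - b -> a <= B -> - B <= b -> k < 1 -> N * w < 2 * B + 2.
Proof. by lra. Qed.

Lemma lag_arith1 {R : realFieldType} (e c R0 q w l l' k : R) : 0 < e ->
  - q - l <= c -> - k <= l' - l -> k <= e -> w <= R0 ->
  - c - e * (1 + R0) - q + e * w <= l'.
Proof. by nra. Qed.

(** The regime of large velocities w = |v|. Of the slope p + 2, the part p pays for p2.v, one unit
    for e|v|, and the last one for the constants, which [w] exceeds. *)
Lemma lag_arith2 {R : realFieldType} (e c R0 p q w l C a b : R) : 0 < e -> e <= 1 ->
  0 <= R0 -> - (p * w) <= q -> 0 <= w -> a + b < w -> - c <= b -> C <= a ->
  (p + 2) * w - C <= l -> - c - e * (1 + R0) - q + e * w <= l.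
Proof. by nra. Qed.

Lemma run_arith {R : realFieldType} (c k q e w f l f' d : R) :
  - c - k - q + e * w <= l -> f - e <= f' -> e * d <= e * w ->
  - (q - e * d) - (c + k - (f - e)) <= l + f'.
Proof. by lra. Qed.

(** Here w = |D|, z = |g(t) - x|, q1 = p2.(g(t) - x), q2 = p2.D. The terms e w and q2 cancel. The
    constant is 4 + R0 = (1 + R0) + 1 + 1 + 1/2 + 1/2: errors from L, from F, from the
    superdifferential, from g(t) - x, and from u(t,g(t)) - u(t,x). *)
Lemma final_arith {R : realFieldType} (e h c R0 f p1 ur ux ug w z y q1 q2 P : R) :
  0 < e -> 0 < h ->
  ur - ux - p1 * - h - (q1 - q2) <= e * (h + y) ->
  y <= w + z -> q1 <= P * z -> (P + e) * z <= e * h / 2 -> ux - e * h / 2 < ug ->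
  - (q2 - e * w) - (c + e * (1 + R0) - (f - e)) * h <= ur - ug ->
  h * (f + p1) <= h * (c + e * (4 + R0)).
Proof. by nra. Qed.

Section line.
Context {R : realType} {n : nat} (x v : 'rV[R]_n) (t h : R).
Hypothesis h0 : 0 < h.

Let clip (s : R) := Num.min (Num.max s t) (t + h).

(** At rest outside [t, t + h], so that the whole curve stays within h|v| of x and is admissible on
    all of [0, T]. *)
Definition line (s : R) : 'rV[R]_n := x + (clip s - t) *: v.

Let clip_itv s : t <= clip s <= t + h.
Proof.
rewrite /clip ge_min lexx orbT andbT le_min le_max lexx orbT/=.
by rewrite lerDl ltW.
Qed.

Let clipE s : t <= s <= t + h -> clip s = s.
Proof. by move=> /andP[ts sh]; rewrite /clip max_l// min_l. Qed.

Lemma lineE s : t <= s <= t + h -> line s = x + (s - t) *: v.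
Proof. by move=> sh; rewrite /line clipE. Qed.

Lemma line_dist s : enorm (line s - x) <= h * enorm v.
Proof.
rewrite /line addrAC subrr add0r enormZ ler_wpM2r ?enorm_ge0//.
by have /andP[ts sh] := clip_itv s; rewrite ger0_norm ?subr_ge0// lerBlDl.
Qed.

Lemma line_abs_cont_on a b : abs_cont_on a b line.
Proof.
apply: (@lipschitz_abs_cont_on _ _ _ _ _ (enorm v)) => s r _ sr _.
rewrite /line opprD addrACA subrr add0r -scalerBl enormZ mulrC.
rewrite ler_wpM2l ?enorm_ge0// /clip /Num.min /Num.max ler_norml.
by apply/andP; split; do 4 case: ifPn; rewrite -?leNgt => *; lra.
Qed.

Lemma derive1_line s : t < s < t + h -> derive1 line s = v.
Proof.
move=> /andP[ts sh].
rewrite (@derive1_near _ _ _ (fun r => (x - t *: v) + r *: v)); last first.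
  near=> r; rewrite lineE; first by rewrite scalerBl addrA addrAC.
  apply/andP; split; apply: ltW; near: r; [exact: lt_nbhsr|exact: lt_nbhsl].
rewrite derive1E.
have := @is_derive_line R _ _ (@id 'rV[R]_n) (x - t *: v) v s.
move=> /(_ ex_diff)[_ ->].
by rewrite diff_val.
Unshelve. all: by end_near. Qed.

End line.

(** * The two inequalities at a point of the superdifferential *)

Section hamilton_jacobi.
Context {R : realType} {n : nat} (T : R) (O U : set 'rV[R]_n).
Context (L : 'rV[R]_n -> 'rV[R]_n -> R) (F G : 'rV[R]_n -> PV R n -> R).
Context (kappa M mu : R) (u : R -> 'rV[R]_n -> R) (m : R -> PV R n).
Hypotheses (T0 : 0 < T) (oO : open O) (OU : closure O `<=` U) (mu0 : 0 < mu)
  (HL : assum_L U L M mu) (HF : assum_FG O U F G kappa)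
  (inPm : forall t, icc 0 T t -> inP O (m t))
  (cont_m : forall t, icc 0 T t -> forall eps : R, 0 < eps ->
     exists2 delta : R, 0 < delta &
     forall s, icc 0 T s -> `|s - t| < delta -> (d1 O (m s) (m t) < eps%:E)%E)
  (Hu : forall t x, icc 0 T t -> closure O x ->
     (u t x)%:E = ereal_inf [set cost L F G m T t g |
                              g in [set g | Gamma O T g /\ g t = x]]).
Local Notation V := 'rV[R]_n.
Local Notation lam := (@lebesgue_measure R).

Let iccE s : icc 0 T s = (0 <= s <= T) :> Prop.
Proof. by rewrite /icc /= in_itv. Qed.

(** Provides the constant under which lower integrals of the running cost can be split and
    cancelled. *)
Lemma running_lower_bound : exists K : R, forall g s, Gamma O T g ->
  0 <= s <= T -> K <= running L F m g s.
Proof.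
have [C CP] := L_superlinear mu0 HL 0; have [D DP] := F_bounded HF inPm cont_m.
exists (- C - D) => g s [_ gO] sT; have Us : U (g s) by apply/OU/gO; rewrite iccE.
apply: lerD; first by have := CP (g s) (derive1 g s) Us; rewrite mul0r add0r.
by have := DP s (g s); rewrite iccE ler_norml => /(_ sT Us) /andP[].
Qed.

Lemma value_le t g : 0 <= t <= T -> Gamma O T g ->
  ((u t (g t))%:E <= cost L F G m T t g)%E.
Proof.
move=> tT Gg; have tT' : icc 0 T t by rewrite iccE.
by rewrite Hu//; [apply: ereal_inf_lbound; exists g|exact: Gg.2].
Qed.

Lemma superdiff_line_ge t x p1 p2 v : 0 < t < T -> O x ->
  superdiff O T u t x (p1, p2) ->
  forall eps : R, 0 < eps ->
    0 <= L x v + F x (m t) + p1 + dotv p2 v + (3 + enorm v) * eps.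
Proof.
move=> /andP[t0 tT] Ox pu e e0; have [K Kr] := running_lower_bound.
have clOx : closure O x by exact: subset_closure.
have Ux : U x by exact: OU.
have tT' : icc 0 T t by rewrite iccE !ltW.
have [d1 d10 ud] := pu e e0.
have [d2 d20 Fd] := F_continuous HF inPm cont_m tT' Ux e0.
have [r0 r00 rO] : exists2 r : R, 0 < r & ball_e x r `<=` O.
  by apply/nbhs_enormP; exact: open_nbhs_nbhs.
have [C C0 LC] : exists2 C : R, 0 <= C & forall y v', enorm (y - x) < r0 ->
    enorm v' <= enorm v -> `|L y v' - L x v'| <= C * enorm (y - x).
  apply: (L_lipschitz HL (enorm_ge0 v)).
  by move=> y /rO Oy; apply/OU/subset_closure.
have C1 : 0 < C + 1 by rewrite ltr_wpDl.
have v1 : 0 < 1 + enorm v by rewrite ltr_wpDr ?enorm_ge0.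
(* In order: the superdifferential inequality, continuity of F, a ball inside [O], and a Lipschitz
   error of L of at most [e]. *)
pose d := Num.min (Num.min d1 d2) (Num.min r0 (e / (C + 1))).
have d0 : 0 < d by rewrite !lt_min d10 d20 r00 divr_gt0.
pose h := Num.min ((T - t) / 2) (d / (2 * (1 + enorm v))).
have h0 : 0 < h by rewrite lt_min !divr_gt0 ?subr_gt0 ?mulr_gt0.
have hT : t + h < T.
  rewrite -ltrBrDl; apply: le_lt_trans (_ : (T - t) / 2 < _).
    by rewrite ge_min lexx.
  by rewrite ltr_pdivrMr// ltr_pMr ?ltr1n// subr_gt0.
have hd : h * (1 + enorm v) < d.
  apply: le_lt_trans (_ : d / 2 < d); last by rewrite ltr_pdivrMr// ltr_pMr// ltr1n.
  have : h <= d / (2 * (1 + enorm v)) by rewrite ge_min lexx orbT.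
  by rewrite invfM mulrA ler_pdivlMr.
have hvd : h * enorm v < d by apply: le_lt_trans hd; rewrite ler_pM2l// lerDr.
have hhd : h < d by apply: le_lt_trans hd; rewrite -[leLHS]mulr1 ler_pM2l// lerDl enorm_ge0.
have th0 : 0 <= t + h by rewrite addr_ge0// ltW.
have thT : 0 <= t + h <= T by rewrite th0 ltW.
have thT' : icc 0 T (t + h) by rewrite iccE.
have near_line s : enorm (line x v t h s - x) < d.
  by apply: le_lt_trans hvd; exact: line_dist.
have line_O s : O (line x v t h s).
  apply: rO; rewrite /ball_e/=; apply: lt_le_trans (near_line s) _.
  by rewrite /d !ge_min lexx !orbT.
have Gl : Gamma O T (line x v t h).
  split; first exact: line_abs_cont_on.
  by move=> s _; exact: subset_closure.
have lh : line x v t h (t + h) = x + h *: v.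
  by rewrite lineE ?lexx ?lerDl ?ltW// addrAC subrr add0r.
have lt_ : line x v t h t = x by rewrite lineE ?lexx ?lerDl ?ltW// subrr scale0r addr0.
have run_le s : `]t, (t + h)[%classic s ->
    running L F m (line x v t h) s <= L x v + F x (m t) + 2 * e.
  rewrite /= in_itv/= => /andP[ts sh].
  rewrite /running derive1_line ?ts//; set y := line x v t h s.
  have yx : enorm (y - x) < d by exact: near_line.
  have L1 : L y v <= L x v + e.
    rewrite -lerBlDl; apply: le_trans (ler_norm _) _.
    apply: le_trans (LC _ _ _ (lexx _)) _.
      by apply: lt_le_trans yx _; rewrite /d !ge_min lexx !orbT.
    apply: (@le_trans _ _ ((C + 1) * (e / (C + 1)))); last by rewrite mulrC divfK ?gt_eqF.
    apply: ler_pM; rewrite ?enorm_ge0 ?lerDl//; apply: ltW; apply: lt_le_trans yx _.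
    by rewrite /d !ge_min lexx !orbT.
  have F1 : F y (m s) <= F x (m t) + e.
    rewrite -lerBlDl; apply: le_trans (ler_norm _) _; apply/ltW/Fd.
    - by rewrite iccE (le_trans (ltW t0) (ltW ts)) (le_trans (ltW sh) (ltW hT)).
    - exact/OU/subset_closure/line_O.
    - rewrite gtr0_norm ?subr_gt0//; apply: lt_le_trans (_ : d <= _).
        by apply: lt_trans hhd; rewrite ltrBlDl.
      by rewrite /d !ge_min lexx !orbT.
    - by apply: lt_le_trans yx _; rewrite /d !ge_min lexx !orbT.
  by rewrite mulrDl mul1r addrACA lerD.
(* Every competitor for the value at (t + h, x + h v) is prolonged backwards by the segment; the
   infimum over competitors is taken only afterwards. *)
have key : u t x - (L x v + F x (m t) + 2 * e) * h <= u (t + h) (x + h *: v).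
  rewrite -lee_fin [leRHS]Hu//; last by rewrite -lh; exact/subset_closure/line_O.
  apply: le_ereal_inf_tmp => _ [g' [Gg' g'h] <-].
  have lg' : line x v t h (t + h) = g' (t + h) by rewrite lh.
  have th := ltW h0; rewrite -(lerDl t) in th.
  have Gg := glue_Gamma thT lg' Gl Gg'.
  have gt : glue_curve (t + h) (line x v t h) g' t = x by rewrite /glue_curve th.
  have t0T : 0 <= t <= T by rewrite !ltW.
  have := value_le t0T Gg; rewrite gt (cost_glue G Kr (ltW t0) th (ltW hT) lg' Gl Gg') => ule.
  rewrite EFinB leeBlDl//; apply: le_trans ule _; rewrite leeD2r//.
  have := @lower_integral_le_cst R (running L F m (line x v t h)) t (t + h) _ K th _ run_le.
  rewrite (addrC t) addrK (addrC h t); apply => s /=; rewrite in_itv/= => /andP[ts sh].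
  by apply: Kr => //; rewrite (le_trans (ltW t0) ts) (le_trans sh (ltW hT)).
have thoo : ioo 0 T (t + h) by rewrite /ioo /= in_itv/= hT andbT addr_gt0.
have xO : closure O (x + h *: v) by rewrite -lh; exact/subset_closure/line_O.
have := ud (t + h) (x + h *: v) thoo xO.
have -> : t + h - t = h by rewrite addrAC subrr add0r.
have -> : x + h *: v - x = h *: v by rewrite addrAC subrr add0r.
have hv_d1 : 0 < h + h * enorm v < d1.
  rewrite -[X in X + _]mulr1 -mulrDr mulr_gt0//=; apply: lt_le_trans hd _.
  by rewrite /d !ge_min lexx.
rewrite enormZ gtr0_norm// dotvZr => /(_ hv_d1) ule.
rewrite -(pmulr_rge0 _ h0).
exact: superdiff_arith key ule.
Qed.

Lemma value_bounded : exists2 B : R, 0 <= B & forall s y, 0 <= s <= T ->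
  closure O y -> `|u s y| <= B.
Proof.
have [K Kr] := running_lower_bound.
have [D DP] := F_bounded HF inPm cont_m.
have TT : icc 0 T T by rewrite iccE lexx ltW.
have [E EP] : exists E : R, forall y, U y -> `|G y (m T)| <= E.
  case: HF => _ /(_ _ (inPm TT))[_ _ [E EP] _] _.
  by exists E => y /EP[].
exists ((`|M| + `|D| + `|K|) * T + `|E|).
  by rewrite addr_ge0// mulr_ge0 ?addr_ge0// ltW.
move=> s y sT Oy; have Uy := OU Oy; have /andP[s0 s1] := sT.
have sT' : icc 0 T s by rewrite iccE.
have EU z : U z -> `|G z (m T)| <= `|E| by move=> /EP /le_trans; apply; exact: ler_norm.
have [Ts0 TsT] : 0 <= T - s /\ T - s <= T by rewrite subr_ge0 s1/= lerBlDl lerDr.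
have Gc : Gamma O T (cst y) by exact: cst_Gamma.
rewrite ler_norml; apply/andP; split; rewrite -lee_fin.
  rewrite Hu//; apply: le_ereal_inf_tmp => _ [g [Gg gs] <-].
  apply: le_trans (_ : ((K * (T - s))%:E + (G (g T) (m T))%:E <= _)%E); last first.
    rewrite leeD2r//; apply: lower_integral_ge_cst => // r; rewrite /= in_itv/=.
    by move=> /andP[sr rT]; apply: Kr => //; rewrite (le_trans s0 sr).
  rewrite -EFinD lee_fin opprD lerD//; last first.
    have := EU (g T) (OU (Gg.2 _ TT)).
    by rewrite ler_norml => /andP[].
  by have := ler_norm (- K); rewrite normrN => kK; apply: value_arith1.
apply: le_trans (value_le sT Gc) _.
apply: le_trans (_ : (((M + D) * (T - s))%:E + (G y (m T))%:E <= _)%E).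
  rewrite leeD2r//; apply: (@lower_integral_le_cst _ _ _ _ _ K) => // r;
    rewrite /= in_itv/= => /andP[sr rT].
    by apply: (Kr (cst y)) => //; rewrite (le_trans s0 sr).
  rewrite derive1_cst lerD//.
    by have [+ _ _] := L_bounds HL Uy; apply: le_trans; exact: ler_norm.
  apply: le_trans (ler_norm _) _; apply: DP => //.
  by rewrite iccE (le_trans s0 (ltW sr)) ltW.
rewrite -EFinD lee_fin lerD//; last by apply: le_trans (EU _ Uy); exact: ler_norm.
by apply: value_arith2 => //; exact: ler_norm.
Qed.

(** The tail of a minimizer is optimal from time r on, while u(s, g(s)) is at most the cost of its
    tail from time s. *)
Lemma running_le_value x0 g r s : minimizers O L F G m T x0 g ->
  0 <= r -> r <= s -> s <= T ->
  (\int[lam]_(z in `[r, s]) (running L F m g z)%:E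
     <= (u r (g r) - u s (g s))%:E)%E.
Proof.
move=> gmin r0 rs sT; have [K Kr] := running_lower_bound.
have [D DP] := F_bounded HF inPm cont_m.
have [Gg g0 _] := gmin; have rT := le_trans rs sT.
have z0 : icc 0 T 0 by rewrite iccE lexx ltW.
have Ux0 : U x0 by rewrite -g0; apply/OU/Gg.2.
have FD z : 0 <= z <= T -> F x0 (m z) <= D.
  by move=> zT; apply: le_trans (ler_norm _) _; apply: DP => //; rewrite iccE.
have rT' : 0 <= r <= T by rewrite r0.
have rT2 : icc 0 T r by rewrite iccE.
have tail := minimizer_tail T0 Kr gmin FD rT'.
have le1 : (cost L F G m T r g <= (u r (g r))%:E)%E.
  rewrite Hu//; last exact: Gg.2.
  by apply: le_ereal_inf_tmp => _ [g' [Gg' g'r] <-]; exact: tail.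
have sT' : 0 <= s <= T by rewrite (le_trans r0 rs).
rewrite EFinB leeBrDr//; apply: le_trans le1.
by rewrite (cost_split _ Kr r0 rs sT Gg) leeD2l// value_le.
Qed.

Lemma minimizers_equicontinuous (rho : R) : 0 < rho -> exists2 h : R, 0 < h &
  forall x0 g r s, minimizers O L F G m T x0 g -> 0 <= r -> r <= s -> s <= T ->
    s - r < h -> enorm (g s - g r) < rho.
Proof.
move=> rho0; have [B B0 uB] := value_bounded; have [K Kr] := running_lower_bound.
have [D DP] := F_bounded HF inPm cont_m.
(* The action of a minimizer over [r, s] is at most 2B; a growth of slope N then gives N |g(s) -
   g(r)| < 2B + 2 = N rho on short intervals. *)
pose N := (2 * B + 2) / rho; have N0 : 0 < N by rewrite divr_gt0// ltr_wpDl// mulr_ge0.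
have [C CP] := L_superlinear mu0 HL N.
have c0 : 0 < `|C + D| + 1 by rewrite ltr_wpDl.
exists (`|C + D| + 1)^-1; first by rewrite invr_gt0.
move=> x0 g r s gmin r0 rs sT srh; have [Gg _ _] := gmin; have rT := le_trans rs sT.
have s0 := le_trans r0 rs.
have gO z : 0 <= z -> z <= T -> closure O (g z).
  by move=> z0 zT; apply: Gg.2; rewrite iccE z0.
have [e e1 eE] := enorm_dual (g s - g r).
have lb : forall z, `]r, s[%classic z ->
    - dotv (- N *: e) (derive1 g z) - (C + D) <= running L F m g z.
  move=> z; rewrite /= in_itv/= => /andP[/ltW rz /ltW zs].
  have z0 := le_trans r0 rz; have zT := le_trans zs sT.
  have Uz := OU (gO _ z0 zT).
  rewrite dotvZl mulNr opprK opprD addrA /running lerD//; last first.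
    have := DP z (g z); rewrite iccE z0 zT ler_norml => /(_ isT Uz) /andP[].
    by [].
  apply: le_trans (CP _ _ Uz); rewrite lerD2r ler_pM2l//.
  by apply: le_trans (ler_dotv _ _) _; rewrite ler_piMl ?enorm_ge0.
have lb' z : `[r, s]%classic z -> K <= running L F m g z.
  rewrite /= in_itv/= => /andP[rz zs]; apply: Kr => //.
  by rewrite (le_trans r0 rz) (le_trans zs sT).
have := lower_integral_ge_dotv T0 Gg.1 r0 rs sT lb' lb.
move=> /le_trans /(_ (running_le_value gmin r0 rs sT)); rewrite lee_fin dotvZl eE.
have ur : u r (g r) <= B.
  by apply: le_trans (ler_norm _) _; apply: uB; [rewrite r0|exact: gO].
have us : - B <= u s (g s).
  by have := uB s (g s); rewrite s0 sT ler_norml => /(_ isT (gO _ s0 sT)) /andP[].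
have cs : (C + D) * (s - r) < 1.
  apply: le_lt_trans (_ : (`|C + D| + 1) * (s - r) < 1).
    rewrite ler_wpM2r ?subr_ge0//; apply: le_trans (ler_norm _) _.
    by rewrite lerDl.
  by rewrite -(ltr_pdivlMl _ _ c0) mulr1.
move=> H; rewrite -(ltr_pM2l N0) [ltRHS]divfK ?gt_eqF//.
exact: equicont_arith H ur us cs.
Qed.

Lemma superdiff_optimal_le t x p1 p2 c : 0 < t < T -> O x ->
  superdiff O T u t x (p1, p2) ->
  (forall eps : R, 0 < eps -> exists2 d : R, 0 < d & forall y, closure O y ->
     enorm (y - x) < d -> `|u t y - u t x| < eps) ->
  (forall r : R, 0 < r -> exists x0 g, minimizers O L F G m T x0 g /\
     enorm (g t - x) < r) ->
  (forall v, - dotv p2 v - L x v <= c) -> F x (m t) + p1 <= c.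
Proof.
move=> /andP[t0 tT] Ox pu cu near_opt Lc; have [K Kr] := running_lower_bound.
have clOx : closure O x by exact: subset_closure.
have Ux : U x by exact: OU.
have tT' : icc 0 T t by rewrite iccE !ltW.
have [C1 C1P] := L_superlinear mu0 HL (enorm p2 + 2).
pose R0 := `|C1| + `|c|; have R00 : 0 <= R0 by rewrite addr_ge0.
have [r0 r00 rO] : exists2 r : R, 0 < r & ball_e x r `<=` O.
  by apply/nbhs_enormP; exact: open_nbhs_nbhs.
have [C C0 LC] : exists2 C : R, 0 <= C & forall y v', enorm (y - x) < r0 ->
    enorm v' <= R0 -> `|L y v' - L x v'| <= C * enorm (y - x).
  apply: (L_lipschitz HL R00).
  by move=> y /rO Oy; apply/OU/subset_closure.
have C10 : 0 < C + 1 by rewrite ltr_wpDl.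
(* The restriction e <= 1 lets [C1] and [R0], chosen before [e], serve for all [e]. *)
suff key e : 0 < e -> e <= 1 -> F x (m t) + p1 <= c + e * (4 + R0).
  apply/ler_addgt0Pr => e e0; have R4 : 0 < 4 + R0 by rewrite ltr_pwDl.
  have := key (Num.min 1 (e / (4 + R0))); rewrite lt_min ltr01 divr_gt0// ge_min lexx.
  move=> /(_ isT isT) /le_trans; apply; rewrite lerD2l.
  by rewrite -ler_pdivlMr// ge_min lexx orbT.
move=> e0 e1.
have [d1 d10 ud] := pu e e0.
have [d2 d20 Fd] := F_continuous HF inPm cont_m tT' Ux e0.
pose d := Num.min (Num.min d1 d2) (Num.min r0 (e / (C + 1))).
have d0 : 0 < d by rewrite !lt_min d10 d20 r00 divr_gt0.
have [dd1 dd2 dr0 ddC] : [/\ d <= d1, d <= d2, d <= r0 & d <= e / (C + 1)].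
  by rewrite /d !ge_min !lexx !orbT.
have L_lb y v : closure O y -> enorm (y - x) < d ->
    - c - e * (1 + R0) - dotv p2 v + e * enorm v <= L y v.
  move=> Oy yx; have p2v := cauchy_schwarz p2 v; rewrite ler_norml in p2v.
  case/andP: p2v => p2v1 p2v2; have v0 := enorm_ge0 v.
  have [vR|Rv] := leP (enorm v) R0.
    have := LC y v (lt_le_trans yx dr0) vR; rewrite ler_norml => /andP[Lyx _].
    have Ce : C * enorm (y - x) <= e.
      apply: (@le_trans _ _ ((C + 1) * (e / (C + 1)))); last by rewrite mulrC divfK ?gt_eqF.
      by apply: ler_pM; rewrite ?enorm_ge0 ?lerDl// ltW// (lt_le_trans yx).
    exact: (lag_arith1 e0 (Lc v) Lyx Ce vR).
  have := C1P y v (OU Oy); have := ler_norm C1; have := ler_norm (- c); rewrite normrN.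
  exact: (lag_arith2 e0 e1 R00 p2v1 v0 Rv).
have [h1 h10 eqc] := minimizers_equicontinuous (divr_gt0 d0 (ltr0n _ 4)).
(* On [t - h, t] the curve moves by less than d/4 and g(t) will be within d/4 of x; together with h
   <= d/4 this keeps (t - h, g(t - h)) within d of (t, x). *)
pose h := Num.min (t / 2) (Num.min (h1 / 2) (d / 4)).
have h0 : 0 < h by rewrite !lt_min !divr_gt0.
have ht : h < t.
  apply: le_lt_trans (_ : t / 2 < _); first by rewrite ge_min lexx.
  by rewrite ltr_pdivrMr// ltr_pMr ?ltr1n.
have hh1 : h < h1.
  apply: le_lt_trans (_ : h1 / 2 < _); first by rewrite !ge_min lexx orbT.
  by rewrite ltr_pdivrMr// ltr_pMr ?ltr1n.
have hd : h <= d / 4 by rewrite !ge_min lexx !orbT.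
have eh0 : 0 < e * h / 2 by rewrite !mulr_gt0.
have [su su0 suP] := cu _ eh0.
have pe0 : 0 < enorm p2 + e by rewrite ltr_wpDl ?enorm_ge0.
(* Chosen after [h], so that replacing x by g(t) costs at most a multiple of e h, which survives the
   division by h. *)
pose sg := Num.min (Num.min su (d / 4)) (e * h / 2 / (enorm p2 + e)).
have sg0 : 0 < sg by rewrite !lt_min su0 !divr_gt0// !mulr_gt0.
have [x0 [g [gmin gx]]] := near_opt _ sg0.
have [gsu gd gpe] : [/\ enorm (g t - x) < su, enorm (g t - x) < d / 4 &
    (enorm p2 + e) * enorm (g t - x) <= e * h / 2].
  split.
  - by apply: lt_le_trans gx _; rewrite !ge_min lexx.
  - by apply: lt_le_trans gx _; rewrite !ge_min lexx orbT.
  - rewrite mulrC -ler_pdivlMr//; apply: ltW; apply: lt_le_trans gx _.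
    by rewrite !ge_min lexx !orbT.
have [Gg _ _] := gmin.
pose r := t - h; have r0' : 0 < r by rewrite subr_gt0.
have rt : r <= t by rewrite lerBlDr lerDl ltW.
have tr : t - r = h by rewrite /r opprB addrCA subrr addr0.
have gO z : 0 <= z -> z <= T -> closure O (g z).
  by move=> z0 zT; apply: Gg.2; rewrite iccE z0.
have g_near z : r <= z -> z <= t -> enorm (g z - x) < d / 2.
  move=> rz zt; apply: le_lt_trans (enorm_triangle _ (g t) _) _.
  have zh : t - z < h1 by apply: le_lt_trans hh1; rewrite -tr lerB.
  have := eqc x0 g z t gmin (le_trans (ltW r0') rz) zt (ltW tT) zh.
  rewrite enormB => gz; apply: lt_le_trans (ltrD gz gd) _.
  exact: quarter_half.
(* As e |v| >= e ev.v, the bound on L becomes linear in the velocity with slope - (p2 - e ev), and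
   its integral recovers e |D|. *)
have [ev ev1 evE] := enorm_dual (g t - g r).
pose cc := c + e * (1 + R0) - (F x (m t) - e).
have lb : forall z, `]r, t[%classic z ->
    - dotv (p2 - e *: ev) (derive1 g z) - cc <= running L F m g z.
  move=> z; rewrite /= in_itv/= => /andP[/ltW rz /ltW zt].
  have z0 := le_trans (ltW r0') rz; have zT := le_trans zt (ltW tT).
  have gzd : enorm (g z - x) < d.
    by apply: lt_trans (g_near _ rz zt) _; rewrite ltr_pdivrMr// ltr_pMr ?ltr1n.
  have H1 := L_lb (g z) (derive1 g z) (gO _ z0 zT) gzd.
  have H2 : F x (m t) - e <= F (g z) (m z).
    have zT' : icc 0 T z by rewrite iccE z0.
    have zd2 : `|z - t| < d2.
      rewrite distrC ger0_norm ?subr_ge0//; apply: lt_le_trans dd2.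
      apply: le_lt_trans (_ : h < d); first by rewrite -tr lerB.
      by apply: le_lt_trans hd _; rewrite ltr_pdivrMr// ltr_pMr ?ltr1n.
    have := Fd z (g z) zT' (OU (gO _ z0 zT)) zd2 (lt_le_trans gzd dd2).
    by rewrite ltr_distl => /andP[/ltW].
  have H3 : e * dotv ev (derive1 g z) <= e * enorm (derive1 g z).
    rewrite ler_pM2l//; apply: le_trans (ler_dotv _ _) _.
    by rewrite ler_piMl ?enorm_ge0.
  rewrite dotvBl dotvZl /running /cc.
  exact: run_arith H1 H2 H3.
have lb' z : `[r, t]%classic z -> K <= running L F m g z.
  rewrite /= in_itv/= => /andP[rz zs]; apply: Kr => //.
  by rewrite (le_trans (ltW r0') rz) (le_trans zs (ltW tT)).
have := lower_integral_ge_dotv T0 Gg.1 (ltW r0') rt (ltW tT) lb' lb.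
move=> /le_trans /(_ (running_le_value gmin (ltW r0') rt (ltW tT))).
rewrite lee_fin tr dotvBl dotvZl evE => Hint.
have roo : ioo 0 T r by rewrite /ioo /= in_itv/= r0' (le_lt_trans rt tT).
have Hu1 := ud r (g r) roo (gO _ (ltW r0') (le_trans rt (ltW tT))).
have rtE : r - t = - h by rewrite -opprB tr.
rewrite rtE normrN gtr0_norm// in Hu1.
have Hd1 : 0 < h + enorm (g r - x) < d1.
  rewrite ltr_wpDr ?enorm_ge0//=; apply: lt_le_trans dd1.
  apply: lt_le_trans (_ : d / 4 + d / 2 <= d).
    by apply: ler_ltD => //; exact: g_near.
  exact: quarter_half_le (ltW d0).
have {}Hu1 := Hu1 Hd1.
have tri : enorm (g r - x) <= enorm (g t - g r) + enorm (g t - x).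
  by rewrite (enormB (g t)); exact: enorm_triangle.
have p2x : dotv p2 (g r - x) = dotv p2 (g t - x) - dotv p2 (g t - g r).
  by rewrite !dotvBr; ring.
have p2gx := ler_dotv p2 (g t - x).
have ugx := suP _ (gO _ (ltW t0) (ltW tT)) gsu.
rewrite ltr_distl in ugx; case/andP: ugx => ugx _.
rewrite -(ler_pM2l h0).
rewrite p2x in Hu1; move: Hint; rewrite /cc.
exact: (final_arith e0 h0 Hu1 tri p2gx gpe ugx).
Qed.

End hamilton_jacobi.

(** * Minimizers passing near a point of the support of m(t) *)

Section equilibrium_curves.
Context {R : realType} {n : nat} (T : R) (O U : set 'rV[R]_n).
Context (L : 'rV[R]_n -> 'rV[R]_n -> R) (F G : 'rV[R]_n -> PV R n -> R).
Context (kappa : R).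
Hypotheses (OU : closure O `<=` U) (HF : assum_FG O U F G kappa).
Local Notation V := 'rV[R]_n.

Lemma ball_e_open (x : V) (r : R) : open (ball_e x r).
Proof.
rewrite openE => y xy; apply/nbhs_enormP; exists (r - enorm (y - x)).
  by rewrite subr_gt0.
move=> z; rewrite /ball_e/= => zy; apply: le_lt_trans (enorm_triangle _ y _) _.
by rewrite -ltrBrDr.
Qed.

Lemma coupling_congr (m1 m2 : PV R n) y : U y -> inP O m1 -> inP O m2 ->
  (forall A : set (BorelV R n), measurable A -> m1 A = m2 A) ->
  F y m1 = F y m2 /\ G y m1 = G y m2.
Proof.
move=> Uy i1 i2 /(d1_eq0 O) d0.
have [/(_ y m1 m2 Uy i1 i2) + _ _] := HF; rewrite d0 mule0 lee_fin => FG.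
have := normr_ge0 (F y m1 - F y m2); have := normr_ge0 (G y m1 - G y m2).
by move=> G0 F0; split; apply/eqP; rewrite -subr_eq0 -normr_le0; lra.
Qed.

(** [equilibrium] comes with a flow of its own, which agrees with that of the mild solution on
    measurable sets only; by (D1) the two flows give the same costs. *)
Lemma minimizers_congr (m1 m2 : R -> PV R n) x g : 0 < T ->
  (forall t, icc 0 T t -> inP O (m1 t)) -> (forall t, icc 0 T t -> inP O (m2 t)) ->
  (forall t, icc 0 T t -> forall A : set (BorelV R n), measurable A ->
     m1 t A = m2 t A) ->
  minimizers O L F G m1 T x g -> minimizers O L F G m2 T x g.
Proof.
move=> T0 i1 i2 m12.
have TT : icc 0 T T by rewrite /icc /= in_itv/= lexx ltW.
have costE g' : Gamma O T g' -> cost L F G m1 T 0 g' = cost L F G m2 T 0 g'.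
  move=> [_ Og']; rewrite /cost; congr (_ + _%:E)%E; last first.
    exact: (coupling_congr (OU (Og' _ TT)) (i1 _ TT) (i2 _ TT) (m12 _ TT)).2.
  apply: eq_integral => s; rewrite inE => sT; congr (_ + _)%:E.
  exact: (coupling_congr (OU (Og' _ sT)) (i1 _ sT) (i2 _ sT) (m12 _ sT)).1.
move=> [Gg g0 gmin]; split => // g' Gg' g'0.
by rewrite -!costE//; exact: gmin.
Qed.

(** A ball around x has positive m(t)-measure, so the curves in that ball at time t form an open set
    of positive [eta]-measure, which meets the support of [eta]. *)
Lemma equilibrium_curve_near m0 eta (m : R -> PV R n) t x : 0 < T ->
  (forall s, icc 0 T s -> inP O (m s)) ->
  equilibrium O L F G T m0 eta -> is_flow T eta m -> icc 0 T t ->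
  meas_supp (m t) x ->
  forall r : R, 0 < r -> exists x0 g, minimizers O L F G m T x0 g /\
    enorm (g t - x) < r.
Proof.
move=> T0 im [etaG [_ [m' [fm' supp]]]] fm tT xsupp r r0.
have oB : open (ball_e x r) by exact: ball_e_open.
have mBorel (A : set V) : open A -> measurable (A : set (BorelV R n)).
  exact: sub_sigma_algebra.
have : (0 < m t (ball_e x r))%E by apply: xsupp => //; rewrite /ball_e/= subrr enorm0.
rewrite (fm t tT _ (mBorel _ oB)) => etaB.
have tT' : 0 <= t <= T by move: tT; rewrite /icc /= in_itv.
have [g sg gx] := curve_supp_meets T0 etaG (sup_open_eval oB tT') etaB.
have [x0 Ox0 gmin] := supp _ sg.
exists x0, g; split => //; apply: minimizers_congr gmin => // s sT.
- rewrite /inP (is_flow_unique fm' fm sT); first exact: im.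
  by apply: mBorel; apply: closed_openC; exact: closed_closure.
- exact: is_flow_unique fm' fm sT.
Qed.

End equilibrium_curves.

Lemma within_continuous_slice {R : realType} {n : nat} (O : set 'rV[R]_n) (T t : R)
    (u : R -> 'rV[R]_n -> R) x :
  {within icc 0 T `*` closure O, continuous (fun z : R * 'rV[R]_n => u z.1 z.2)} ->
  icc 0 T t -> closure O x ->
  forall eps : R, 0 < eps -> exists2 d : R, 0 < d & forall y, closure O y ->
    enorm (y - x) < d -> `|u t y - u t x| < eps.
Proof.
move=> cu tT Ox e e0.
have /subspace_continuousP/(_ (t, x) (conj tT Ox)) := cu.
move=> /cvgrPdist_lt/(_ e e0) [[P Q] /= [tP xQ] PQ].
have [d d0 dQ] := (nbhs_enormP _ _).1 xQ; exists d => // y Oy yx.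
rewrite distrC; apply: (PQ (t, y)) => //; split => //=; first exact: nbhs_singleton.
exact: dQ.
Qed.

Unset Implicit Arguments.
Set Strict Implicit.

Theorem theorem4p10 (R : realType) (n : nat) (T : R)
  (Omega U : set 'rV[R]_n)
  (L : 'rV[R]_n -> 'rV[R]_n -> R) (F G : 'rV[R]_n -> PV R n -> R)
  (kappa M mu : R)
  (m0 : PV R n) (u : R -> 'rV[R]_n -> R) (m : R -> PV R n)
  (t : R) (x : 'rV[R]_n) (p1 : R) (p2 : 'rV[R]_n) :
  0 < T ->
  open Omega -> bounded_set Omega -> C2_boundary Omega ->
  open U -> closure Omega `<=` U ->
  0 < mu ->
  assum_L U L M mu ->
  assum_FG Omega U F G kappa ->
  mild_solution Omega L F G T m0 u m ->
  Qm Omega T m (t, x) ->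
  superdiff Omega T u t x (p1, p2) ->
  ((- p1)%:E + hamiltonian L x p2 = (F x (m t))%:E)%E.
Proof.
move=> T0 oO _ _ _ OU mu0 HL HF [cu inPm cont_m [eta [equ fm Hu]]].
move=> [/= tT Ox xsupp] pu.
have tT' : 0 < t < T by move: tT; rewrite /ioo /= in_itv.
have tTc : icc 0 T t by case/andP: tT' => t0 t1; rewrite /icc /= in_itv/= !ltW.
have clOx : closure Omega x by exact: subset_closure.
have near_opt := equilibrium_curve_near OU HF T0 inPm equ fm tTc xsupp.
have cont_u := within_continuous_slice cu tTc clOx.
have ub v : - dotv p2 v - L x v <= F x (m t) + p1.
  rewrite -subr_ge0; apply/ler_addgt0Pr => e e0.
  have v3 : 0 < 3 + enorm v by rewrite ltr_pwDl ?enorm_ge0.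
  have := superdiff_line_ge oO OU mu0 HL HF inPm cont_m Hu v tT' Ox pu
            (divr_gt0 e0 v3).
  by rewrite [(3 + _) * _]mulrC divfK ?gt_eqF//; lra.
have Hub : (hamiltonian L x p2 <= (F x (m t) + p1)%:E)%E.
  by apply: ge_ereal_sup => _ [v _ <-]; rewrite lee_fin.
have Hlb v : ((- dotv p2 v - L x v)%:E <= hamiltonian L x p2)%E.
  by apply: ereal_sup_ubound; exists v.
(* The first inequality bounds the supremum from above, and the velocity 0 bounds it from below. *)
have Hfin : hamiltonian L x p2 \is a fin_num.
  rewrite fin_numElt (lt_le_trans _ (Hlb 0)) ?ltNyr//=.
  by rewrite (le_lt_trans Hub) ?ltry.
have Hge : F x (m t) + p1 <= fine (hamiltonian L x p2).
  apply: (superdiff_optimal_le T0 oO OU mu0 HL HF inPm cont_m Hu tT' Ox pu) => // v.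
  by rewrite -lee_fin fineK.
rewrite -(fineK Hfin) in Hub *; rewrite lee_fin in Hub.
by have <- : F x (m t) + p1 = fine (hamiltonian L x p2);
  [apply/eqP; rewrite eq_le Hub Hge|rewrite -EFinD addrCA addNr addr0].
Qed.
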